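(* The decision problem HOMFULL — given an oriented graph $G$, decide whether $G$ is homomorphically full — is GI-hard.
   Context: An oriented graph is a finite simple loopless graph in which each edge is assigned a direction. A homomorphism of oriented graphs maps vertices to vertices so that arcs go to arcs; it is complete if surjective on vertices and on arcs. A homomorphic image of an oriented graph $G$ is an oriented graph $H$ (no loops, no directed $2$-cycles) with a complete homomorphism $G\to H$. $G$ is homomorphically full if every homomorphic image of $G$ is isomorphic to a subgraph of $G$. A problem is GI-hard if the graph isomorphism problem is polynomial-time reducible to it. *)

(* Defs.v *)
From mathcomp Require Import all_boot matrix.

Set Implicit Arguments.
Unset Strict Implicit.
Unset Printing Implicit Defensive.

Structure digraph := Digraph { vertex :> finType; is_arc : rel vertex }.

(* An undirected edge is represented by its two opposite arcs. *)
Definition simple_graph (G : digraph) : Prop :=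
  irreflexive (@is_arc G) /\ symmetric (@is_arc G).

Definition oriented_graph (G : digraph) : Prop :=
  irreflexive (@is_arc G) /\ forall u v : G, is_arc u v -> ~~ is_arc v u.

Definition isomorphic (G H : digraph) : Prop :=
  exists2 f : G -> H, bijective f & {mono f : u v / is_arc u v}.

Definition complete_homomorphism (G H : digraph) (f : G -> H) : Prop :=
  [/\ {homo f : u v / is_arc u v},
      forall x : H, exists u, f u = x
    & forall x y : H, is_arc x y ->
        exists u, exists v, [/\ is_arc u v, f u = x & f v = y]].

Definition homomorphic_image (G H : digraph) : Prop :=
  oriented_graph H /\ exists f : G -> H, complete_homomorphism f.

(* Not necessarily induced subgraphs. *)
Definition subgraph_spec (G : digraph) (W : {set G}) (S : {set G * G}) : Prop :=
  forall u v : G, (u, v) \in S -> [/\ u \in W, v \in W & is_arc u v].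

Definition subgraph (G : digraph) (W : {set G}) (S : {set G * G}) : digraph :=
  @Digraph {u : G | u \in W} (fun u v => (val u, val v) \in S).

Definition homomorphically_full (G : digraph) : Prop :=
  forall H : digraph, homomorphic_image G H ->
    exists W S, subgraph_spec W S /\ isomorphic H (@subgraph G W S).

(* Deterministic Turing machines with [extra_tapes.+1] two-way infinite tapes. *)

(* [None] is the blank, [Some (inl b)] an input/output bit, [Some (inr a)] an
   auxiliary work symbol. *)
Definition symbol (A : finType) : finType := option (bool + A)%type.

Definition blank {A : finType} : symbol A := None.
Definition bit {A : finType} (b : bool) : symbol A := Some (inl b).

Inductive direction := Left | Stay | Right.

Record machine := Machine {
  extra_tapes : nat;
  work_symbol : finType;
  state : finType;
  start : state;
  halting : pred state;
  transition :
    state -> {ffun 'I_extra_tapes.+1 -> symbol work_symbol} ->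
    state * ('I_extra_tapes.+1 -> symbol work_symbol * direction)
}.

(* [before] is listed from the scanned cell leftwards, [after] rightwards; all
   cells beyond the two lists are blank. *)
Record tape (A : finType) := Tape {
  before : seq (symbol A);
  scanned : symbol A;
  after : seq (symbol A)
}.

Definition write_move (A : finType) (t : tape A)
    (act : symbol A * direction) : tape A :=
  let: (a, d) := act in
  match d with
  | Left => Tape (behead (before t)) (head blank (before t)) (a :: after t)
  | Stay => Tape (before t) a (after t)
  | Right => Tape (a :: before t) (head blank (after t)) (behead (after t))
  end.

Definition blank_tape (A : finType) : tape A := Tape [::] blank [::].

Definition input_tape (A : finType) (w : seq bool) : tape A :=
  let cells := map bit w in Tape [::] (head blank cells) (behead cells).

Definition holds_word (A : finType) (t : tape A) (w : seq bool) : Prop :=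
  exists m, scanned t :: after t = map bit w ++ nseq m blank.

Record config (M : machine) := Config {
  control : state M;
  tapes : 'I_(extra_tapes M).+1 -> tape (work_symbol M)
}.

Definition initial (M : machine) (w : seq bool) : config M :=
  Config (start M)
    (fun i => if i == ord0 then input_tape (work_symbol M) w
              else blank_tape (work_symbol M)).

Definition step (M : machine) (c : config M) : config M :=
  if halting (control c) then c else
  let: (q, act) :=
    transition (control c) [ffun i => scanned (tapes c i)] in
  Config q (fun i => write_move (tapes c i) (act i)).

(* Input and output are both on tape [ord0]; halting configurations are fixed
   by [step], so this bounds the running time by [t]. *)
Definition computes_within (M : machine) (w w' : seq bool) (t : nat) : Prop :=
  let c := iter t (@step M) (initial M w) in
  halting (control c) /\ holds_word (tapes c ord0) w'.

(* The instances are the elements of [raw] satisfying [legal]. *)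
Record problem := Problem {
  raw :> Type;
  legal : raw -> Prop;
  yes : raw -> Prop;
  code : raw -> seq bool;
  code_inj : injective code
}.

Definition poly_time (P Q : problem) (f : P -> Q) : Prop :=
  exists M c k, forall x : P, legal x ->
    computes_within M (code x) (code (f x)) (c * size (code x) ^ k + c).

(* Many-one (Karp) reducibility. *)
Definition poly_reducible (P Q : problem) : Prop :=
  exists f : P -> Q,
    [/\ poly_time f,
        forall x : P, legal x -> legal (f x)
      & forall x : P, legal x -> (yes x <-> yes (f x))].

Record adjacency := Adjacency { order : nat; entries : 'M[bool]_order }.

Definition graph_of (A : adjacency) : digraph :=
  @Digraph 'I_(order A) (fun i j => entries A i j).

(* The order in unary, terminated by [false], then the matrix row by row. *)
Definition adjacency_code (A : adjacency) : seq bool :=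
  nseq (order A) true ++ false ::
  [seq entries A i j | i <- enum 'I_(order A), j <- enum 'I_(order A)].

Definition pair_code (AB : adjacency * adjacency) : seq bool :=
  adjacency_code AB.1 ++ adjacency_code AB.2.

Lemma adjacency_code_cat_inj A B s t :
  adjacency_code A ++ s = adjacency_code B ++ t -> A = B /\ s = t.
Proof.
case: A B => [n A] [m B]; rewrite /adjacency_code /= -!catA.
have Enm: forall (n m : nat) (s t : seq bool),
    nseq n true ++ false :: s = nseq m true ++ false :: t -> n = m /\ s = t.
  elim=> [|p IH] [|q] s' t' //=; first by case.
  by case=> /IH[-> ->].
move=> /Enm[Emn]; subst m.
move/eqP; rewrite eqseq_cat ?size_allpairs // => /andP[/eqP E /eqP ->]; split=> //.
congr Adjacency; apply/matrixP=> i j.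
have entries_eq: forall (r1 r2 : seq 'I_n),
    [seq A i j | i <- r1, j <- r2] = [seq B i j | i <- r1, j <- r2] ->
    forall i j, i \in r1 -> j \in r2 -> A i j = B i j.
  move=> r1 r2; elim: r1 => //= a r1 IH /eqP.
  rewrite eqseq_cat ?size_map // => /andP[/eqP/eq_in_map Ea /eqP/IH {}IH] i' j'.
  by rewrite inE => /predU1P[-> /Ea|/IH]; last exact.
by apply: (entries_eq _ _ E); rewrite mem_enum.
Qed.

Lemma adjacency_code_inj : injective adjacency_code.
Proof.
by move=> A B E; case: (@adjacency_code_cat_inj A B [::] [::]); rewrite ?E.
Qed.

Lemma pair_code_inj : injective pair_code.
Proof.
move=> [A A'] [B B'] /adjacency_code_cat_inj[/= -> /adjacency_code_inj ->] //.
Qed.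

Definition GI : problem :=
  @Problem (adjacency * adjacency)
    (fun AB => simple_graph (graph_of AB.1) /\ simple_graph (graph_of AB.2))
    (fun AB => isomorphic (graph_of AB.1) (graph_of AB.2))
    pair_code pair_code_inj.

Definition HOMFULL : problem :=
  @Problem adjacency
    (fun A => oriented_graph (graph_of A))
    (fun A => homomorphically_full (graph_of A))
    adjacency_code adjacency_code_inj.

Definition GI_hard (P : problem) : Prop := poly_reducible GI P.

(* Main.v *)
From HB Require Import structures.
From mathcomp Require Import all_boot matrix zify.
Require Import Defs.

Set Implicit Arguments.
Unset Strict Implicit.
Unset Printing Implicit Defensive.

(* Two vertices of an oriented graph that are joined by an arc or by a directed
   path of length 2 have distinct images under every homomorphism. Given A and
   B, let S be an oriented graph all of whose pairs are joined in this way, made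
   of a directed 4-cycle c0 c1 c2 c3, of two hubs d0 and d1, and of an encoding
   K of the disjoint union of A and B; c_i has an arc to d_(i mod 2) and one
   from the other hub, and d0, d1 tell the vertices of A from those of B. To S
   we add a partial copy a of c0 and a partial copy b of c1, joined by an arc
   from a to b but not from a to c1. The only pairs that can be identified are
   {a, c0} and {b, c1}. Identifying a with c0, or both pairs, gives retracts.
   Identifying only b with c1 turns the pair (a, c0) into a copy of the pair
   (b, c1) shifted by one step along the cycle, so this image embeds as soon as
   S has an automorphism rotating the cycle; it exchanges d0 and d1, hence A
   and B. Conversely an embedding of this image yields an endomorphism
   identifying exactly b and c1; followed by the retraction onto S it induces
   an automorphism of S, which is forced to send c0 to c1, hence to rotate the
   cycle and to exchange A and B. *)

(** * Programs for three tapes *)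

Section Programs.

Variable A : finType.
Notation sym := (symbol A).
Notation action := (sym * direction)%type.

Definition tapes3 := (tape A * tape A * tape A)%type.
Definition reads := (sym * sym * sym)%type.
Definition actions := (action * action * action)%type.

Definition reading (T : tapes3) : reads :=
  (scanned T.1.1, scanned T.1.2, scanned T.2).

Definition perform (T : tapes3) (a : actions) : tapes3 :=
  (write_move T.1.1 a.1.1, write_move T.1.2 a.1.2, write_move T.2 a.2).

(** A structured language in place of transition tables: effects and running times compose along
    [Seq] and [While], and [compile] turns the result into a machine. *)
Inductive prog :=
| Act of (reads -> actions)
| Seq of prog & prog
| While of (reads -> bool) & prog.

Fixpoint pstate (p : prog) : finType :=
  match p with
  | Act _ => unit : finType
  | Seq p q => (pstate p + pstate q)%type : finType
  | While _ p => option (pstate p) : finType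
  end.

Fixpoint pstart (p : prog) : pstate p :=
  match p with
  | Act _ => tt
  | Seq p q => inl (pstart p)
  | While _ p => None
  end.

Definition idle (r : reads) : actions :=
  ((r.1.1, Stay), (r.1.2, Stay), (r.2, Stay)).

(** [None] as the next state means that the program has ended. In a [While] the state [None] is the
    test of the guard, which costs one idle step per round and one at the exit. *)
Fixpoint ptrans (p : prog) : pstate p -> reads -> option (pstate p) * actions :=
  match p with
  | Act f => fun _ r => (None, f r)
  | Seq p q => fun s r =>
      match s with
      | inl s => let: (o, a) := ptrans s r in
                 (Some (if o is Some s' then inl s' else inr (pstart q)), a)
      | inr s => let: (o, a) := ptrans s r in (omap inr o, a)
      end
  | While c p => fun s r =>
      match s with
      | None => (if c r then Some (Some (pstart p)) else None, idle r)
      | Some s => let: (o, a) := ptrans s r in (Some o, a)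
      end
  end.

Definition pstep (p : prog) (c : option (pstate p) * tapes3) :=
  if c.1 is Some s then
    let: (o, a) := ptrans s (reading c.2) in (o, perform c.2 a)
  else c.

(** Ended programs stay put, so [t] is an upper bound on the running time. *)
Definition runs (p : prog) (t : nat) (T T' : tapes3) :=
  iter t (@pstep p) (Some (pstart p), T) = (None, T').

Lemma pstep_running p s T :
  @pstep p (Some s, T) =
  let: (o, a) := ptrans s (reading T) in (o, perform T a).
Proof. by []. Qed.

Lemma iter_pstep_done p t T : iter t (@pstep p) (None, T) = (None, T).
Proof. by elim: t => //= t ->. Qed.

Lemma runs_le p t t' T T' : t <= t' -> runs p t T T' -> runs p t' T T'.
Proof. by rewrite /runs => /subnK<- E; rewrite iterD E iter_pstep_done. Qed.

Lemma perform_idle T : perform T (idle (reading T)) = T.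
Proof. by case: T => [[[? ? ?] [? ? ?]] [? ? ?]]. Qed.

Lemma runs_act f T : runs (Act f) 1 T (perform T (f (reading T))).
Proof. by []. Qed.

(** [p] may end before [t] steps, and [Seq] then enters [q] at once; hence the inequality. *)
Lemma iter_seq_left p q t s T T' :
  iter t (@pstep p) (Some s, T) = (None, T') ->
  exists2 t', t' <= t &
    iter t' (@pstep (Seq p q)) (Some (inl s : pstate (Seq p q)), T) = (Some (inr (pstart q)), T').
Proof.
elim: t s T => [//|t IH] s T; rewrite iterSr pstep_running /=.
case E: (ptrans s _) => [[s'|] a] /=.
  move=> /IH[t' le_t' Et']; exists t'.+1 => //.
  by rewrite iterSr pstep_running /= E.
rewrite iter_pstep_done => -[<-]; exists 1 => //.
by rewrite /= /pstep /= E.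
Qed.

Lemma iter_seq_right p q t s T T' :
  iter t (@pstep q) (Some s, T) = (None, T') ->
  iter t (@pstep (Seq p q)) (Some (inr s : pstate (Seq p q)), T) = (None, T').
Proof.
elim: t s T => [//|t IH] s T; rewrite !iterSr !pstep_running /=.
case: (ptrans s _) => [[s'|] a] /=; first exact: IH.
by rewrite iter_pstep_done => -[<-]; exact: (@iter_pstep_done (Seq p q)).
Qed.

Lemma runs_seq p q t1 t2 T T1 T2 :
  runs p t1 T T1 -> runs q t2 T1 T2 -> runs (Seq p q) (t1 + t2) T T2.
Proof.
move=> E1 E2; have [t' le_t' {}E1] := @iter_seq_left p q _ _ _ _ E1.
have {}E2 := @iter_seq_right p q _ _ _ _ E2.
apply: (@runs_le _ (t' + t2)); first by rewrite leq_add2r.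
by rewrite /runs addnC iterD E1.
Qed.

Lemma iter_while_body c p t s T T' :
  iter t (@pstep p) (Some s, T) = (None, T') ->
  exists2 t', t' <= t &
    iter t' (@pstep (While c p)) (Some (Some s : pstate (While c p)), T) = (Some None, T').
Proof.
elim: t s T => [//|t IH] s T; rewrite iterSr pstep_running /=.
case E: (ptrans s _) => [[s'|] a] /=.
  move=> /IH[t' le_t' Et']; exists t'.+1 => //.
  by rewrite iterSr pstep_running /= E.
rewrite iter_pstep_done => -[<-]; exists 1 => //.
by rewrite /= /pstep /= E.
Qed.

Lemma runs_while_stop (c : reads -> bool) p T : ~~ c (reading T) -> runs (While c p) 1 T T.
Proof.
by move=> nc; rewrite /runs /= /pstep /= (negPf nc) perform_idle.
Qed.

Lemma runs_while_next (c : reads -> bool) p t1 t2 T T1 T2 :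
  c (reading T) -> runs p t1 T T1 -> runs (While c p) t2 T1 T2 ->
  runs (While c p) (t1 + t2).+1 T T2.
Proof.
move=> cT E1 E2; have [t' le_t' {}E1] := @iter_while_body c p _ _ _ _ E1.
apply: (@runs_le _ (t' + t2).+1); first by rewrite ltnS leq_add2r.
by rewrite /runs iterSr pstep_running /= cT perform_idle addnC iterD E1.
Qed.

Definition tape_of (T : tapes3) (i : 'I_3) : tape A :=
  match nat_of_ord i with 0 => T.1.1 | 1 => T.1.2 | _ => T.2 end.

Definition action_of (a : actions) (i : 'I_3) : action :=
  match nat_of_ord i with 0 => a.1.1 | 1 => a.1.2 | _ => a.2 end.

Definition compile (p : prog) : machine :=
  @Machine 2 A (option (pstate p)) (Some (pstart p)) (fun s => ~~ s)
    (fun s r =>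
       let r3 := (r (inord 0), r (inord 1), r (inord 2)) in
       if s is Some s then let: (o, a) := ptrans s r3 in (o, action_of a)
       else (None, action_of (idle r3))).

(** Tapes are compared pointwise, which avoids equalities between functions. *)
Lemma step_compile p (c : config (compile p)) (d : option (pstate p) * tapes3) :
  control c = d.1 -> (forall i, tapes c i = tape_of d.2 i) ->
  control (step c) = (pstep d).1 /\
  forall i, tapes (step c) i = tape_of (pstep d).2 i.
Proof.
case: c d => [q V] [o T] /= -> ET; rewrite /step /pstep /=.
case: o => [s|] //=; rewrite !ffunE !ET /tape_of !inordK // -/(reading T).
case: (ptrans s _) => [o a] /=; split=> // i.
by rewrite ET /perform /tape_of /action_of; case: i => [[|[|[|]]]].
Qed.

Lemma compile_computes p t (w w' : seq bool) T' :
  runs p t (input_tape A w, blank_tape A, blank_tape A) T' ->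
  holds_word T'.1.1 w' ->
  computes_within (compile p) w w' t.
Proof.
rewrite /runs => Ht Hw; rewrite /computes_within.
pose d0 := (Some (pstart p), (input_tape A w, blank_tape A, blank_tape A)).
have [Ec Et] : control (iter t (@step (compile p)) (initial (compile p) w))
      = (iter t (@pstep p) d0).1 /\
    forall i, tapes (iter t (@step (compile p)) (initial (compile p) w)) i
      = tape_of (iter t (@pstep p) d0).2 i.
  elim: t {Ht} => [|t [IH1 IH2]] /=; last exact: step_compile.
  by split=> // i; rewrite /tape_of; case: i => [[|[|[|]]]].
by rewrite /= Ec Et Ht.
Qed.

End Programs.

(** * Homomorphically full graphs *)

Definition embeds (H G : digraph) : Prop :=
  exists2 g : H -> G, injective g & {homo g : x y / is_arc x y}.

(** Subgraphs need not be induced, so the images of the vertices and of the arcs under an injective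
    homomorphism form the required subgraph. *)
Lemma homomorphically_fullP (G : digraph) :
  homomorphically_full G <->
  (forall H, homomorphic_image G H -> embeds H G).
Proof.
split=> full H /full {full}.
  move=> [W [S [spec [f [f' fK f'K] mf]]]]; exists (fun x => val (f x)).
    by move=> x y /val_inj /(can_inj fK).
  by move=> x y; rewrite -mf => /spec[].
move=> [g injg homg].
pose S := [set p | [exists x, exists y, is_arc x y && (p == (g x, g y))]].
exists [set g x | x in H], S; split.
  move=> u v; rewrite inE => /existsP[x /existsP[y /andP[xy /eqP[-> ->]]]].
  by split; rewrite ?imset_f ?homg.
have gP x : g x \in [set g x | x in H] by rewrite imset_f.
exists (fun x => exist _ (g x) (gP x)); last first.
  move=> x y; apply: etrans (_ : (g x, g y) \in S = _) => //; rewrite inE; apply/existsP/idP.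
    by move=> [x' /existsP[y' /andP[? /eqP[/injg-> /injg->]]]].
  by move=> xy; exists x; apply/existsP; exists y; rewrite xy eqxx.
have pre (u : {u : G | u \in [set g x | x in H]}) : exists x, g x == val u.
  by case: u => /= u /imsetP[x _ ->]; exists x.
exists (fun u => xchoose (pre u)).
  by move=> x; apply: injg; apply/eqP; exact: xchooseP (pre _).
by move=> u; apply: val_inj => /=; apply/eqP; exact: xchooseP (pre u).
Qed.

Lemma isomorphic_full (G G' : digraph) :
  isomorphic G G' -> homomorphically_full G -> homomorphically_full G'.
Proof.
move=> [f [f' fK f'K] mf] /homomorphically_fullP full.
apply/homomorphically_fullP => H [oH [h [homh surjh arch]]].
have [|g injg homg] := full H.
  split=> //; exists (h \o f); split=> [u v|x|x y] /=.
  - by rewrite -mf => /homh.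
  - by have [u <-] := surjh x; exists (f' u); rewrite f'K.
  - move=> /arch[u [v [uv <- <-]]]; exists (f' u), (f' v).
    by rewrite -mf !f'K.
exists (f \o g); first exact: inj_comp (can_inj fK) injg.
by move=> x y /homg; rewrite -mf.
Qed.

(** The finite set of related pairs is mapped injectively into itself, hence onto itself. *)
Lemma injective_homo_mono (T : finType) (e : rel T) (f : T -> T) :
  injective f -> {homo f : x y / e x y} -> {mono f : x y / e x y}.
Proof.
move=> injf homf x y; apply/idP/idP => [efxy|/homf//].
pose E := [set p : T * T | e p.1 p.2]; pose F (p : T * T) := (f p.1, f p.2).
have injF : injective F by move=> [a b] [c d] [/injf-> /injf->].
have FE : F @: E = E.
  apply/eqP; rewrite eqEcard card_imset // leqnn andbT.
  by apply/subsetP=> _ /imsetP[p pE ->]; move: pE; rewrite !inE /= => /homf.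
have : F (x, y) \in F @: E by rewrite FE inE.
by rewrite mem_imset // inE.
Qed.

(** An endomorphism with the kernel of [f] factors through [f], and the factor is injective; it
    preserves arcs because every arc of [H] lifts to [G]. *)
Lemma embeds_endo (G H : digraph) (f : G -> H) (e : G -> G) :
  complete_homomorphism f -> {homo e : x y / is_arc x y} ->
  (forall x y, f x = f y <-> e x = e y) -> embeds H G.
Proof.
move=> [_ surjf arcf] home kerE.
have pre x : exists u, f u == x by have [u <-] := surjf x; exists u.
have preP u : e (xchoose (pre (f u))) = e u.
  by apply/kerE/eqP/(xchooseP (pre (f u))).
exists (fun x => e (xchoose (pre x))).
  move=> x y; have [[u <-] [v <-]] := (surjf x, surjf y).
  by rewrite !preP => /kerE.
by move=> _ _ /arcf[u [v [uv <- <-]]]; rewrite !preP; exact: home.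
Qed.

(** * The graph of the reduction *)

(* The 4-cycle [BC0], ..., [BC3], the partial copies [BA] of [BC0] and [BB] of
   [BC1], and the hub [BD s] of each side [s] ([false] for A, [true] for B). *)
Inductive base := BA | BB | BC0 | BC1 | BC2 | BC3 | BD of bool.

Definition bases := [:: BA; BB; BC0; BC1; BC2; BC3; BD false; BD true].

Definition base_index (x : base) : nat :=
  match x with
  | BA => 0 | BB => 1 | BC0 => 2 | BC1 => 3 | BC2 => 4 | BC3 => 5
  | BD t => 6 + t
  end.

Lemma base_indexK : cancel base_index (nth BA bases).
Proof. by case=> // [[]]. Qed.

HB.instance Definition _ := Countable.copy base (can_type base_indexK).

Fact bases_axiom : Finite.axiom bases.
Proof. by case=> // [[]]. Qed.

HB.instance Definition _ := isFinite.Build base bases_axiom.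

Inductive layer := L0 | L1 | L2.

Definition layers := [:: L0; L1; L2].

Definition layer_index (l : layer) : nat :=
  match l with L0 => 0 | L1 => 1 | L2 => 2 end.

Lemma layer_indexK : cancel layer_index (nth L0 layers).
Proof. by case. Qed.

HB.instance Definition _ := Countable.copy layer (can_type layer_indexK).

Fact layers_axiom : Finite.axiom layers.
Proof. by case. Qed.

HB.instance Definition _ := isFinite.Build layer layers_axiom.

Definition base_arc (x y : base) : bool :=
  match x, y with
  | BA, BB | BA, BD false
  | BB, BC2 | BB, BD true
  | BC0, BC1 | BC0, BB | BC0, BD false
  | BC1, BC2 | BC1, BD true
  | BC2, BC3 | BC2, BD false
  | BC3, BC0 | BC3, BA | BC3, BD true
  | BD false, BC1 | BD false, BC3
  | BD true, BC0 | BD true, BC2 => true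
  | _, _ => false
  end.

(** The hubs identify the layers: both receive arcs from [L1], both send arcs to [L2], and on [L0]
    they disagree according to the side. *)
Definition base_layer_arc (x : base) (l : layer) (s : bool) : bool :=
  match x, l with
  | BD t, L0 => s == t
  | BD t, L1 => false
  | _, _ => true
  end.

Definition layer_base_arc (l : layer) (s : bool) (x : base) : bool :=
  ~~ base_layer_arc x l s.

(* Every vertex of A and B has one copy in each layer. Copies in [L0] and [L1],
   and in [L2] and [L0], are matched; [L2] and [L1] carry the adjacency. *)
Definition layer_arc (l l' : layer) (same adj : bool) : bool :=
  match l, l' with
  | L0, L1 => same
  | L1, L0 => ~~ same
  | L2, L0 => same
  | L0, L2 => ~~ same
  | L2, L1 => adj
  | L1, L2 => ~~ adj
  | _, _ => false
  end.

Definition base_twins (x y : base) : bool :=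
  match x, y with
  | BA, BC0 | BC0, BA | BB, BC1 | BC1, BB => true
  | _, _ => false
  end.

Lemma base_non_twins_linked (x y : base) :
  [|| x == y, base_twins x y, base_arc x y, base_arc y x,
      has (fun z => base_arc x z && base_arc z y) bases
    | has (fun z => base_arc y z && base_arc z x) bases].
Proof. by case: x => [||||||[]]; case: y => [||||||[]]. Qed.

Definition merge (p q : bool) (x : base) : base :=
  match x with
  | BA => if p then BC0 else BA
  | BB => if q then BC1 else BB
  | _ => x
  end.

(** Merging [BB] alone fails at the arc from [BA] to [BB], as there is none from [BA] to [BC1]. *)
Lemma merge_homo p q : q ==> p -> {homo merge p q : c d / base_arc c d}.
Proof. by case: p; case: q => // _ [||||||[]] [||||||[]]. Qed.

Definition rotate (x : base) : base :=
  match x with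
  | BA => BB
  | BB | BC1 => BC2
  | BC0 => BC1
  | BC2 => BC3
  | BC3 => BC0
  | BD t => BD (~~ t)
  end.

Lemma rotate_homo : {homo rotate : c d / base_arc c d}.
Proof. by move=> [||||||[]] [||||||[]]. Qed.

(** * What homomorphisms of the gadget can identify *)

Section Gadget.

Variables (I : finType) (side : I -> bool) (adj : rel I).

Definition gadget_vertex := (base + I * layer)%type.

Definition gadget_arc (x y : gadget_vertex) : bool :=
  match x, y with
  | inl c, inl d => base_arc c d
  | inl c, inr (v, l) => base_layer_arc c l (side v)
  | inr (u, l), inl d => layer_base_arc l (side u) d
  | inr (u, l), inr (v, l') => layer_arc l l' (u == v) (adj u v)
  end.

Definition gadget : digraph := @Digraph gadget_vertex gadget_arc.

Lemma gadget_arcE (x y : gadget) : is_arc x y = gadget_arc x y.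
Proof. by []. Qed.

Hypothesis adj_sym : symmetric adj.

(** Between two layers exactly one of two opposite arcs is present; for [L1] and [L2] this is the
    symmetry of [adj]. *)
Lemma gadget_oriented : oriented_graph gadget.
Proof.
split.
  by case=> [[||||||[]]|[u []]].
case=> [c|[u l]] [d|[v l']]; rewrite !gadget_arcE /=.
- by case: c => [||||||[]]; case: d => [||||||[]].
- by rewrite /layer_base_arc negbK.
- by rewrite /layer_base_arc.
- by rewrite [v == u]eq_sym [adj v u]adj_sym; case: l; case: l'; rewrite //= negbK.
Qed.

Definition twins (x y : gadget) : bool :=
  if (x, y) is (inl c, inl d) then base_twins c d else false.

Lemma non_twins_linked (x y : gadget) :
  x <> y -> ~~ twins x y ->
  [\/ is_arc x y, is_arc y x,
      exists z, is_arc x z /\ is_arc z y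
    | exists z, is_arc y z /\ is_arc z x].
Proof.
move=> neq_xy.
have E1 z : is_arc x z -> is_arc z y -> [\/ is_arc x y, is_arc y x,
      exists z, is_arc x z /\ is_arc z y
    | exists z, is_arc y z /\ is_arc z x] by move=> ? ?; apply: Or43; exists z.
have E2 z : is_arc y z -> is_arc z x -> [\/ is_arc x y, is_arc y x,
      exists z, is_arc x z /\ is_arc z y
    | exists z, is_arc y z /\ is_arc z x] by move=> ? ?; apply: Or44; exists z.
case: x y neq_xy E1 E2 => [c|[u l]] [d|[v l']] neq_xy E1 E2.
- move=> /negPf ntw; have := base_non_twins_linked c d.
  have -> : base_twins c d = false by [].
  case: eqP => [Ecd|_]; rewrite ?orFb; first by case: neq_xy; rewrite Ecd.
  case/or4P => [cd|dc|/hasP[z _ /andP[]]|/hasP[z _ /andP[]]].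
  - by apply: Or41.
  - by apply: Or42.
  - exact: (E1 (inl z)).
  - exact: (E2 (inl z)).
- move=> _; rewrite !gadget_arcE /= /layer_base_arc.
  by case: base_layer_arc; [apply: Or41 | apply: Or42].
- move=> _; rewrite !gadget_arcE /= /layer_base_arc.
  by case: base_layer_arc; [apply: Or42 | apply: Or41].
move=> _; case: (eqVneq l l') neq_xy E1 E2 => [<-|neq_l] neq_xy E1 E2.
  have /negPf neq_uv : u != v by apply/eqP => Euv; apply: neq_xy; rewrite Euv.
  (* There are no arcs inside a layer; a matched copy of [u] or [v] is the middle of a directed path
     from [x] to [y]. *)
  case: l {neq_xy} E1 E2 => E1 E2.
  - by apply: (E1 (inr (u, L1))); rewrite !gadget_arcE /= ?eqxx ?neq_uv.
  - by apply: (E1 (inr (v, L0))); rewrite !gadget_arcE /= ?eqxx ?neq_uv.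
  - by apply: (E1 (inr (u, L0))); rewrite !gadget_arcE /= ?eqxx ?neq_uv.
rewrite !gadget_arcE /= [v == u]eq_sym [adj v u]adj_sym.
case: l l' neq_l {neq_xy E1 E2} => [] [] //= _;
  first [by case: (u == v); [apply: Or41 | apply: Or42]
        | by case: (u == v); [apply: Or42 | apply: Or41]
        | by case: (adj u v); [apply: Or41 | apply: Or42]
        | by case: (adj u v); [apply: Or42 | apply: Or41]].
Qed.

(** Identifying the ends of an arc would give a loop, and identifying those of a directed path of
    length 2 a directed 2-cycle. *)
Lemma homo_twins (H : digraph) (f : gadget -> H) x y :
  oriented_graph H -> {homo f : x y / is_arc x y} ->
  f x = f y -> x = y \/ twins x y.
Proof.
move=> [irrH asymH] homf Exy; case: (eqVneq x y) => [|/eqP neq_xy]; first by left.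
right; apply/negPn/negP => ntw.
case: (non_twins_linked neq_xy ntw) => [/homf|/homf|[z [xz zy]]|[z [yz zx]]].
- by rewrite Exy irrH.
- by rewrite Exy irrH.
- by have := asymH _ _ (homf _ _ xz); rewrite Exy homf.
- by have := asymH _ _ (homf _ _ yz); rewrite -Exy homf.
Qed.

Definition gadget_map (eb : base -> base) (h : I -> I) (x : gadget) : gadget :=
  match x with inl c => inl (eb c) | inr (u, l) => inr (h u, l) end.

Lemma gadget_map_homo eb h :
  {homo eb : c d / base_arc c d} ->
  (forall c l u, base_layer_arc (eb c) l (side (h u)) = base_layer_arc c l (side u)) ->
  injective h -> {mono h : u v / adj u v} ->
  {homo gadget_map eb h : x y / is_arc x y}.
Proof.
move=> homb homs injh mh [c|[u l]] [d|[v l']]; rewrite !gadget_arcE /=.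
- exact: homb.
- by rewrite homs.
- by rewrite /layer_base_arc homs.
- by rewrite (inj_eq injh) mh.
Qed.

(** Both maps identify at most twins, so the kernels need comparing only on twins. *)
Lemma gadget_map_kernel (H : digraph) (f : gadget -> H) eb h :
  homomorphic_image gadget H -> {homo f : x y / is_arc x y} -> injective h ->
  (forall c d, eb c = eb d -> c = d \/ base_twins c d) ->
  (forall c d, base_twins c d -> f (inl c) = f (inl d) <-> eb c = eb d) ->
  forall x y, f x = f y <-> gadget_map eb h x = gadget_map eb h y.
Proof.
move=> [oH _] homf injh ebtw ker x y; split=> [Exy|].
  case/(homo_twins oH homf): (Exy) => [->//|].
  by case: x y Exy => [c|[u l]] [d|[v l']] //= Exy /ker[/(_ Exy) -> _].
case: x y => [c|[u l]] [d|[v l']] //=.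
  case=> Ecd; case: (ebtw _ _ Ecd) => [->//|tw].
  by apply/(ker _ _ tw).
by case=> /injh-> ->.
Qed.

(** * Fullness from an exchange of the two sides *)

Lemma merge_embeds (H : digraph) (f : gadget -> H) :
  oriented_graph H -> complete_homomorphism f ->
  (f (inl BB) = f (inl BC1) -> f (inl BA) = f (inl BC0)) -> embeds H gadget.
Proof.
move=> oH cf impl; have [homf _ _] := cf.
pose p := f (inl BA) == f (inl BC0); pose q := f (inl BB) == f (inl BC1).
apply: (embeds_endo cf) (_ : {homo gadget_map (merge p q) id : x y / is_arc x y}) _.
  apply: gadget_map_homo => //; last by case; rewrite /merge; case: p; case: q.
  by apply: merge_homo; apply/implyP=> /eqP/impl/eqP.
apply: (gadget_map_kernel (conj oH (ex_intro _ f cf))) => //.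
  by move=> c d; rewrite /merge; case: p; case: q; case: c => [||||||[]]; case: d => [||||||[]] //; auto.
by move=> [||||||[]] [||||||[]] //= _; rewrite /p /q; case: eqP => E; split=> // E2; case: E; rewrite E2.
Qed.

(** [rotate] exchanges the hubs, which the exchange of sides by [h] compensates on [L0]. *)
Lemma rotate_embeds (H : digraph) (f : gadget -> H) (h : I -> I) :
  oriented_graph H -> complete_homomorphism f ->
  injective h -> (forall u, side (h u) = ~~ side u) -> {mono h : u v / adj u v} ->
  f (inl BB) = f (inl BC1) -> f (inl BA) <> f (inl BC0) -> embeds H gadget.
Proof.
move=> oH cf injh sideh mh EB nEA; have [homf _ _] := cf.
apply: (embeds_endo cf) (_ : {homo gadget_map rotate h : x y / is_arc x y}) _.
  apply: gadget_map_homo => //; first exact: rotate_homo.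
  by move=> [||||||[]] [] u //=; rewrite sideh; case: (side u).
apply: (gadget_map_kernel (conj oH (ex_intro _ f cf))) => //.
  by move=> [||||||[]] [||||||[]] //; auto.
by move=> [||||||[]] [||||||[]] //= _; split=> // E; case: nEA.
Qed.

Lemma swap_full (h : I -> I) :
  injective h -> (forall u, side (h u) = ~~ side u) -> {mono h : u v / adj u v} ->
  homomorphically_full gadget.
Proof.
move=> injh sideh mh; apply/homomorphically_fullP => H [oH [f cf]].
case: (eqVneq (f (inl BA)) (f (inl BC0))) => [EA|/eqP nEA].
  exact: (@merge_embeds H f).
case: (eqVneq (f (inl BB)) (f (inl BC1))) => [EB|/eqP nEB].
  exact: (@rotate_embeds H f h).
by apply: (@merge_embeds H f) => // /nEB.
Qed.

(** * The image that identifies only [BB] with [BC1] *)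

Definition fold_arc : rel {x : gadget_vertex | x != inl BB} := fun x y =>
  gadget_arc (val x) (val y) || (val x == inl BA) && (val y == inl BC1).

(** The class of [BB] and [BC1] is represented by [BC1]. Its only new arc comes from [BA]: all other
    arcs at [BB] are already present at [BC1]. *)
Definition fold_graph : digraph := @Digraph {x : gadget_vertex | x != inl BB} fold_arc.

Definition fold_point : fold_graph := exist _ (inl BC1 : gadget_vertex) isT.

Definition fold (x : gadget) : fold_graph := insubd fold_point x.

Lemma val_fold x : val (fold x) = if x == inl BB then inl BC1 else x.
Proof. by rewrite val_insubd; case: ifP => [/negPf->//|/negbFE/eqP->]; rewrite eqxx. Qed.

Lemma fold_arcE (x y : fold_graph) : is_arc x y =
  gadget_arc (val x) (val y) || (val x == inl BA) && (val y == inl BC1).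
Proof. by []. Qed.

Lemma fold_oriented : oriented_graph fold_graph.
Proof.
have [irr asym] := gadget_oriented; split.
- by move=> x; rewrite fold_arcE [gadget_arc _ _]irr; case: eqP => // ->.
- move=> x y; rewrite !fold_arcE => /orP[xy|/andP[/eqP-> /eqP->]//].
  rewrite [gadget_arc _ _](negPf (asym _ _ xy)) orFb.
  by apply/andP=> -[/eqP Ey /eqP Ex]; move: xy; rewrite Ex Ey.
Qed.

Lemma fold_complete : complete_homomorphism fold.
Proof.
have foldK (x : fold_graph) : fold (val x) = x.
  by apply: val_inj; rewrite val_fold (negPf (valP x)).
split.
- move=> x y; rewrite fold_arcE !val_fold.
  case: x => [c|[u l]]; case: y => [d|[v l']]; rewrite gadget_arcE //.
  + by case: c => [||||||[]]; case: d => [||||||[]].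
  + by case: c => [||||||[]] /=; rewrite ?andbF ?orbF; case: l'.
  + by case: d => [||||||[]] /=; rewrite ?andbF ?orbF; case: l.
  + by move=> uv; apply/orP; left.
- by move=> x; exists (val x).
move=> x y; rewrite fold_arcE => /orP[xy|/andP[/eqP Ex /eqP Ey]].
  by exists (val x), (val y).
by exists (inl BA), (inl BB); split=> //; apply: val_inj; rewrite val_fold ?Ex ?Ey.
Qed.

Lemma fold_eq x y : fold x = fold y ->
  x = y \/ (x = inl BB /\ y = inl BC1) \/ (x = inl BC1 /\ y = inl BB).
Proof.
move/(congr1 val); rewrite !val_fold.
by case: eqP => [->|_]; case: eqP => [->|_]; auto.
Qed.

(** The vertices of S. No two of them are twins, so homomorphisms to oriented graphs are injective
    on them. *)
Definition core (x : gadget) : bool := (x != inl BA) && (x != inl BB).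

Lemma core_no_twins x y : core x -> core y -> ~~ twins x y.
Proof. by case: x => [[||||||[]]|[u l]]; case: y => [[||||||[]]|[v l']]. Qed.

(** * The automorphism of S induced by an embedding *)

Section Endomorphism.

(** In [full_swap] this is [fold] followed by an embedding of [fold_graph]. *)
Variable psi : gadget -> gadget.
Hypothesis psi_homo : {homo psi : x y / is_arc x y}.
Hypothesis psi_fold : psi (inl BB) = psi (inl BC1).
Hypothesis psi_eq : forall x y, psi x = psi y ->
  x = y \/ (x = inl BB /\ y = inl BC1) \/ (x = inl BC1 /\ y = inl BB).

Let rho := gadget_map (merge true true) id.
Let theta x := rho (psi x).

Lemma rho_homo : {homo rho : x y / is_arc x y}.
Proof.
apply: gadget_map_homo => //; first exact: merge_homo.
by case.
Qed.

Lemma theta_homo : {homo theta : x y / is_arc x y}.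
Proof. by move=> x y /psi_homo/rho_homo. Qed.

Lemma theta_core x : core (theta x).
Proof. by rewrite /theta; case: (psi x) => [[||||||[]]|[u l]]. Qed.

Lemma theta_eq x y : theta x = theta y -> x = y \/ twins x y.
Proof. exact: (homo_twins gadget_oriented theta_homo). Qed.

Lemma theta_inj x y : core x -> core y -> theta x = theta y -> x = y.
Proof.
by move=> cx cy /theta_eq[//|]; rewrite (negPf (core_no_twins cx cy)).
Qed.

(** Extending by the identity gives an injective self-map of a finite type, to which counting
    applies. *)
Let theta' x := if core x then theta x else x.

Lemma theta'_inj : injective theta'.
Proof.
move=> x y; rewrite /theta'; case: ifP => cx; case: ifP => cy //.
- exact: theta_inj.
- by move=> E; rewrite -E theta_core in cy.
- by move=> E; rewrite E theta_core in cx.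
Qed.

Lemma theta_mono x y : core x -> core y -> is_arc (theta x) (theta y) = is_arc x y.
Proof.
move=> cx cy; pose e (x y : gadget) := [&& core x, core y & is_arc x y].
have home : {homo theta' : x y / e x y}.
  move=> u v /and3P[cu cv uv].
  by rewrite /e /theta' cu cv !theta_core theta_homo.
have := injective_homo_mono theta'_inj home x y.
by rewrite /e /theta' cx cy !theta_core.
Qed.

Lemma theta_onto z : core z -> exists2 y, core y & theta y = z.
Proof.
move=> cz; have [g _ gK] := injF_bij theta'_inj.
have := gK z; rewrite /theta'; case: ifP => [cy <-|ncy E]; first by exists (g z).
by rewrite E cz in ncy.
Qed.

(* [theta] is already onto when restricted to the core, and [BC0] is the only
   core vertex that can share its image with [BA]. *)
Lemma theta_twin : theta (inl BA) = theta (inl BC0).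
Proof.
have [y cy Ey] := theta_onto (theta_core (inl BA)).
case/theta_eq: (Ey) => [E|]; first by rewrite E in cy.
by rewrite -Ey; case: y cy {Ey} => [[||||||[]]|[u l]].
Qed.

(** [psi] separates [BA] from [BC0] while [rho] identifies their images, so these images are twins:
    [BA] and [BC0] in some order, or [BB] and [BC1]. In the first case both have an arc to
    [psi (inl BC1)], because [psi] sends [BB] there too. *)
Lemma psi_twins :
  theta (inl BC0) = inl BC0 /\ gadget_arc (inl BA) (psi (inl BC1)) /\
    (forall x, psi x = inl BA \/ psi x = inl BC0 -> x = inl BA \/ x = inl BC0) \/
  theta (inl BC0) = inl BC1.
Proof.
have AB : is_arc (psi (inl BA)) (psi (inl BC1)) by rewrite -psi_fold; exact: psi_homo.
have C01 : is_arc (psi (inl BC0)) (psi (inl BC1)) by exact: psi_homo.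
have nE : psi (inl BA) <> psi (inl BC0) by case/psi_eq=> [|[[]|[]]].
have back x y z : psi x = z -> psi y = z -> y = inl BA \/ y = inl BC0 -> x = y.
  by move=> <- /psi_eq[<-//|[[-> _]|[-> _]]] [].
move: theta_twin nE AB C01; rewrite /theta.
case E1: (psi (inl BA)) => [[||||||[]]|[u l]] //;
case E2: (psi (inl BC0)) => [[||||||[]]|[v l']] //= _ _ AB C01; auto.
- left; split=> //; split=> // x [Ex|Ex].
    by left; apply: back Ex E1 _; left.
  by right; apply: back Ex E2 _; right.
- left; split=> //; split=> // x [Ex|Ex].
    by right; apply: back Ex E2 _; right.
  by left; apply: back Ex E1 _; left.
Qed.

Lemma theta_arc x y : core x -> core y ->
  gadget_arc (theta x) (theta y) = gadget_arc x y.
Proof. exact: theta_mono. Qed.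

(** If [theta] fixed [BC0], it would fix [BC2], the only other core vertex not adjacent to [BC0],
    and then [BC1], the only core vertex on a directed path of length 2 from [BC0] to [BC2]. *)
Lemma theta_BC0 : theta (inl BC0) = inl BC1.
Proof.
case: psi_twins => [[E0 [Apsi back]]|//]; exfalso.
have E2 : theta (inl BC2) = inl BC2.
  have := theta_core (inl BC2).
  have := @theta_arc (inl BC0) (inl BC2) isT isT.
  have := @theta_arc (inl BC2) (inl BC0) isT isT.
  have : theta (inl BC2) <> theta (inl BC0) by move/theta_inj=> /(_ isT isT).
  rewrite E0 /=; case: (theta _) => [[||||||[]]|[u []]] //.
have E1 : theta (inl BC1) = inl BC1.
  have := theta_core (inl BC1).
  have := @theta_arc (inl BC0) (inl BC1) isT isT.
  have := @theta_arc (inl BC1) (inl BC2) isT isT.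
  rewrite E0 E2 /=; case: (theta _) => [[||||||[]]|[u []]] //.
(* [rho] sends only [BB] and [BC1] to [BC1], and [BA] has no arc to [BC1]. *)
have psi1 : psi (inl BC1) = inl BB.
  by move: E1 Apsi; rewrite /theta; case: (psi _) => [[||||||[]]|[u []]].
(* [BB] has no in-neighbours but [BA] and [BC0], so [psi] would send [BD false] to one of these,
   against [back]. *)
have : gadget_arc (psi (inl (BD false))) (psi (inl BC1)) by exact: psi_homo.
have := back (inl (BD false)); rewrite psi1.
case: (psi _) => [[||||||[]]|[u []]] // H _.
  by case: H; [left|..].
by case: H; [right|..].
Qed.

(** The image of [BC0] determines that of [BC2], the cycle vertex not adjacent to it; every other
    base vertex of the core is then the only middle of a directed path of length 2 between vertices
    whose images are known. *)
Lemma theta_rotates :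
  [/\ theta (inl BC1) = inl BC2, theta (inl BC2) = inl BC3, theta (inl BC3) = inl BC0
    & forall t, theta (inl (BD t)) = inl (BD (~~ t))].
Proof.
have E0 := theta_BC0.
have E2 : theta (inl BC2) = inl BC3.
  have := theta_core (inl BC2).
  have := @theta_arc (inl BC0) (inl BC2) isT isT.
  have := @theta_arc (inl BC2) (inl BC0) isT isT.
  have : theta (inl BC2) <> theta (inl BC0) by move/theta_inj=> /(_ isT isT).
  by rewrite E0 /=; case: (theta _) => [[||||||[]]|[u []]].
have E1 : theta (inl BC1) = inl BC2.
  have := theta_core (inl BC1).
  have := @theta_arc (inl BC0) (inl BC1) isT isT.
  have := @theta_arc (inl BC1) (inl BC2) isT isT.
  by rewrite E0 E2 /=; case: (theta _) => [[||||||[]]|[u []]].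
have E3 : theta (inl BC3) = inl BC0.
  have := theta_core (inl BC3).
  have := @theta_arc (inl BC2) (inl BC3) isT isT.
  have := @theta_arc (inl BC3) (inl BC0) isT isT.
  by rewrite E0 E2 /=; case: (theta _) => [[||||||[]]|[u []]].
split=> // -[].
  have := theta_core (inl (BD true)).
  have := @theta_arc (inl (BD true)) (inl BC0) isT isT.
  have := @theta_arc (inl BC1) (inl (BD true)) isT isT.
  by rewrite E0 E1 /=; case: (theta _) => [[||||||[]]|[u []]].
have := theta_core (inl (BD false)).
have := @theta_arc (inl (BD false)) (inl BC1) isT isT.
have := @theta_arc (inl BC0) (inl (BD false)) isT isT.
by rewrite E0 E1 /=; case: (theta _) => [[||||||[]]|[u []]].
Qed.

Lemma endomorphism_swap : exists h : I -> I,
  [/\ injective h, forall u, side (h u) = ~~ side u & {mono h : u v / adj u v}].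
Proof.
have [E1 E2 E3 ED] := theta_rotates; have E0 := theta_BC0.
(* The image receives arcs from the whole cycle, so it lies in a layer; its arcs with the exchanged
   hubs give the layer [L0] and the other side. *)
have lay0 u : exists v, theta (inr (u, L0)) = inr (v, L0) /\ side v = ~~ side u.
  have := @theta_arc (inl BC0) (inr (u, L0)) isT isT.
  have := @theta_arc (inl BC1) (inr (u, L0)) isT isT.
  have := @theta_arc (inl BC2) (inr (u, L0)) isT isT.
  have := @theta_arc (inl BC3) (inr (u, L0)) isT isT.
  have := @theta_arc (inl (BD (side u))) (inr (u, L0)) isT isT.
  have := @theta_arc (inr (u, L0)) (inl (BD (~~ side u))) isT isT.
  have := theta_core (inr (u, L0)).
  rewrite !ED E0 E1 E2 E3 /= /layer_base_arc /= negbK eqxx.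
  case: (side u); case: (theta _) => [[||||||[]]|[v []]] //=;
  by case Sv: (side v) => //= *; exists v.
have lay1 u : exists v, theta (inr (u, L1)) = inr (v, L1).
  have := @theta_arc (inr (u, L1)) (inl (BD true)) isT isT.
  have := @theta_arc (inr (u, L1)) (inl (BD false)) isT isT.
  have := theta_core (inr (u, L1)).
  rewrite !ED /= /layer_base_arc /=.
  case: (theta _) => [[||||||[]]|[v []]] //=; last by exists v.
  by case: (side v).
have lay2 u : exists v, theta (inr (u, L2)) = inr (v, L2).
  have := @theta_arc (inl (BD true)) (inr (u, L2)) isT isT.
  have := @theta_arc (inl (BD false)) (inr (u, L2)) isT isT.
  have := theta_core (inr (u, L2)).
  rewrite !ED /=.
  case: (theta _) => [[||||||[]]|[v []]] //=; last by exists v.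
  by case: (side v).
(* By [lay0] the default is never taken. The matchings then carry [h] from [L0] to [L1] and [L2],
   and the arcs from [L2] to [L1] show that it preserves [adj]. *)
pose h u := if theta (inr (u, L0)) is inr (v, _) then v else u.
have h0 u : theta (inr (u, L0)) = inr (h u, L0).
  by have [v [E _]] := lay0 u; rewrite /h E.
have h1 u : theta (inr (u, L1)) = inr (h u, L1).
  have [v E] := lay1 u; have := @theta_arc (inr (u, L0)) (inr (u, L1)) isT isT.
  by rewrite h0 E /= eqxx => /eqP->.
have h2 u : theta (inr (u, L2)) = inr (h u, L2).
  have [v E] := lay2 u; have := @theta_arc (inr (u, L2)) (inr (u, L0)) isT isT.
  by rewrite h0 E /= eqxx => /eqP->.
exists h; split.
- move=> u v E; suff: inr (u, L0) = inr (v, L0) :> gadget by case.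
  by apply: theta_inj; rewrite // !h0 E.
- by move=> u; have [v [E <-]] := lay0 u; rewrite /h E.
- move=> u v; have := @theta_arc (inr (u, L2)) (inr (v, L1)) isT isT.
  by rewrite h2 h1.
Qed.

End Endomorphism.

Lemma full_swap : homomorphically_full gadget -> exists h : I -> I,
  [/\ injective h, forall u, side (h u) = ~~ side u & {mono h : u v / adj u v}].
Proof.
move=> /homomorphically_fullP/(_ _ (conj fold_oriented (ex_intro _ _ fold_complete)))[g injg homg].
apply: (@endomorphism_swap (g \o fold)).
- by move=> x y xy; apply: homg; case: fold_complete => + _ _; exact.
- by congr g; apply: val_inj; rewrite !val_fold.
- by move=> x y /injg/fold_eq.
Qed.

End Gadget.

(** * The reduction *)

Lemma isomorphic_sym (G H : digraph) : isomorphic G H -> isomorphic H G.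
Proof.
move=> [f [g fK gK] mf]; exists g; first by exists f.
by move=> x y; rewrite -mf !gK.
Qed.

(** The machine writes rows in a definite order, so vertices are numbered along an explicit list. *)
Definition listed (V : Type) (e : rel V) (s : seq V) : adjacency :=
  @Adjacency (size s) (\matrix_(i, j) e (tnth (in_tuple s) i) (tnth (in_tuple s) j)).

Lemma listed_code V (e : rel V) s : adjacency_code (listed e s) =
  nseq (size s) true ++ false :: [seq e u v | u <- s, v <- s].
Proof.
rewrite /adjacency_code /=; congr (_ ++ _ :: _).
transitivity [seq e u v | u <- map (tnth (in_tuple s)) (enum 'I_(size s)),
                          v <- map (tnth (in_tuple s)) (enum 'I_(size s))].
  rewrite allpairs_mapl allpairs_mapr.
  by apply: eq_allpairs => i j; rewrite mxE.
by rewrite map_tnth_enum.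
Qed.

Lemma listed_isomorphic (V : finType) (e : rel V) (s : seq V) :
  uniq s -> (forall x, x \in s) -> isomorphic (@Digraph V e) (graph_of (listed e s)).
Proof.
move=> us fs; apply: isomorphic_sym.
have inj_s : injective (tnth (in_tuple s)) by exact/tuple_uniqP.
exists (tnth (in_tuple s)); last by move=> i j; rewrite /= mxE.
have sE x : (index x s < size s)%N by rewrite index_mem.
exists (fun x => Ordinal (sE x)) => [i|x].
  by apply: inj_s; rewrite [LHS](tnth_nth (tnth (in_tuple s) i)) /= nth_index.
by rewrite (tnth_nth x) /= nth_index.
Qed.

(** * Isomorphisms as exchanges of the two sides *)

Section PairGadget.

Variables A B : adjacency.
Notation I := ('I_(order A) + 'I_(order B))%type.

Definition pair_side (u : I) : bool := if u is inr _ then true else false.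

Definition pair_adj (u v : I) : bool :=
  match u, v with
  | inl i, inl j => entries A i j
  | inr i, inr j => entries B i j
  | _, _ => false
  end.

Definition pair_list : seq I :=
  map inl (enum 'I_(order A)) ++ map inr (enum 'I_(order B)).

Lemma pair_list_uniq : uniq pair_list.
Proof.
rewrite cat_uniq; apply/and3P; split.
- by rewrite map_inj_uniq => [|? ? []//]; exact: enum_uniq.
- by apply/hasPn => _ /mapP[i _ ->]; apply/mapP=> -[].
- by rewrite map_inj_uniq => [|? ? []//]; exact: enum_uniq.
Qed.

Lemma mem_pair_list u : u \in pair_list.
Proof. by rewrite mem_cat; case: u => i; rewrite map_f ?mem_enum ?orbT. Qed.

(** [h] restricts to injections in both directions between the two vertex sets; by cardinality, the
    one from A is bijective. *)
Lemma swap_isomorphic (h : I -> I) :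
  injective h -> (forall u, pair_side (h u) = ~~ pair_side u) ->
  {mono h : u v / pair_adj u v} -> isomorphic (graph_of A) (graph_of B).
Proof.
move=> injh sideh mh.
have fP i : {j | h (inl i) = inr j}.
  by have := sideh (inl i); case: (h (inl i)) => // j; exists j.
have gP j : {i | h (inr j) = inl i}.
  by have := sideh (inr j); case: (h (inr j)) => // i; exists i.
pose f i := sval (fP i); have fE i : h (inl i) = inr (f i) := svalP (fP i).
pose g j := sval (gP j); have gE j : h (inr j) = inl (g j) := svalP (gP j).
have injf : injective f by move=> i i' E; have /injh[] : h (inl i) = h (inl i') by rewrite !fE E.
have injg : injective g by move=> i i' E; have /injh[] : h (inr i) = h (inr i') by rewrite !gE E.
exists f.
  apply: inj_card_bij injf _; exact: leq_card injg.
by move=> i j /=; have := mh (inl i) (inl j); rewrite !fE.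
Qed.

Lemma isomorphic_swap : isomorphic (graph_of A) (graph_of B) -> exists h : I -> I,
  [/\ injective h, forall u, pair_side (h u) = ~~ pair_side u
    & {mono h : u v / pair_adj u v}].
Proof.
move=> [f [g fK gK] mf].
exists (fun u => match u with inl i => inr (f i) | inr j => inl (g j) end); split.
- by move=> [i|i] [j|j] // [] => [/(can_inj fK)|/(can_inj gK)] ->.
- by case.
- by move=> [i|i] [j|j] //=; [exact: mf | have /esym := mf (g i) (g j); rewrite !gK].
Qed.

End PairGadget.

(** The copies of a vertex are consecutive, so their three rows are written before the machine
    leaves its input row. *)
Definition gadget_list (I : Type) (us : seq I) : seq (base + I * layer) :=
  map inl bases ++ [seq inr (u, l) | u <- us, l <- layers].

Definition reduction (AB : adjacency * adjacency) : adjacency :=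
  listed (gadget_arc (@pair_side AB.1 AB.2) (@pair_adj AB.1 AB.2))
    (gadget_list (pair_list AB.1 AB.2)).

Lemma size_gadget_list I (us : seq I) : size (gadget_list us) = 8 + 3 * size us.
Proof. by rewrite size_cat !size_map size_allpairs mulnC. Qed.

Lemma reduction_isomorphic AB : isomorphic
  (gadget (@pair_side AB.1 AB.2) (@pair_adj AB.1 AB.2)) (graph_of (reduction AB)).
Proof.
apply: listed_isomorphic.
  rewrite cat_uniq; apply/and3P; split.
  - by rewrite map_inj_uniq => [|? ? []].
  - apply/hasPn=> _ /allpairsP[? [_ _ ->]].
    by apply/mapP=> -[].
  - apply: allpairs_uniq => //; first exact: pair_list_uniq.
    by move=> [? ?] [? ?] _ _ [-> ->].
rewrite /gadget_list; case=> [c|[u l]]; rewrite mem_cat.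
  by rewrite map_f //; case: c => [||||||[]].
rewrite [X in _ || X]allpairs_f ?orbT ?mem_pair_list //; by case: l.
Qed.

Lemma pair_adj_sym AB : legal (p := GI) AB -> symmetric (@pair_adj AB.1 AB.2).
Proof.
move=> [[_ symA] [_ symB]] [i|i] [j|j] //=; [exact: symA | exact: symB].
Qed.

Lemma isomorphic_oriented (G H : digraph) :
  isomorphic G H -> oriented_graph G -> oriented_graph H.
Proof.
move=> [f [g fK gK] mf] [irr asym]; split=> [x|x y].
  by rewrite -[x]gK mf irr.
by rewrite -[x]gK -[y]gK !mf; exact: asym.
Qed.

Lemma reduction_legal AB : legal (p := GI) AB -> legal (p := HOMFULL) (reduction AB).
Proof.
move=> lAB; apply: isomorphic_oriented (reduction_isomorphic AB) _.
exact: gadget_oriented (pair_adj_sym lAB).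
Qed.

Lemma reduction_correct AB : legal (p := GI) AB ->
  yes (p := GI) AB <-> yes (p := HOMFULL) (reduction AB).
Proof.
move=> lAB; have sym := pair_adj_sym lAB; have iso := reduction_isomorphic AB.
split.
  move=> /isomorphic_swap[h [injh sideh mh]].
  exact: isomorphic_full iso (swap_full sym injh sideh mh).
move=> /(isomorphic_full (isomorphic_sym iso))/(full_swap sym)[h [injh sideh mh]].
exact: swap_isomorphic injh sideh mh.
Qed.

(** * The machine *)

(* On the second tape, [None] is an end marker and [Some (s, m)] stands for a
   vertex of the [s]-th input graph, with mark [m]. *)
Definition mark : finType := option (bool * bool).
Notation sym := (symbol mark).

Definition stop : sym := Some (inr None).
Definition cell (c : bool * bool) : sym := Some (inr (Some c)).

Definition side_of (x : sym) : bool := if x is Some (inr (Some c)) then c.1 else false.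
Definition mark_of (x : sym) : bool := if x is Some (inr (Some c)) then c.2 else false.
Definition has_side (S : pred bool) (x : sym) : bool :=
  if x is Some (inr (Some c)) then S c.1 else false.

(* The head scans the first symbol of [r]; [l] is to its left, nearest first. *)
Definition tape_at (l r : seq sym) : tape mark := Tape l (head blank r) (behead r).

Definition wrote (w : seq bool) (l : seq sym) : seq sym := rev (map bit w) ++ l.

Lemma wrote_cat w w' l : wrote w' (wrote w l) = wrote (w ++ w') l.
Proof. by rewrite /wrote map_cat rev_cat catA. Qed.

Definition emit (g : sym -> sym -> bool) : prog mark :=
  Act (fun r => ((r.1.1, Stay), (r.1.2, Stay), (bit (g r.1.1 r.1.2), Right))).

Definition emits (gs : seq (sym -> sym -> bool)) : prog mark :=
  foldr (fun g p => Seq (emit g) p) (Act (@idle mark)) gs.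

Lemma emits_runs gs l0 r0 l1 r1 o :
  runs (emits gs) (size gs).+1 (tape_at l0 r0, tape_at l1 r1, tape_at o [::])
    (tape_at l0 r0, tape_at l1 r1,
     tape_at (wrote [seq g (head blank r0) (head blank r1) | g <- gs] o) [::]).
Proof.
elim: gs o => [|g gs IH] o //=.
rewrite /wrote /= rev_cons cat_rcons -add1n.
by apply: (runs_seq (runs_act _ _)); exact: IH.
Qed.

(** One pass over the listed vertices. The first head moves only at vertices whose side is in [S],
    and thus reads along an input row; [pred0] keeps it still. *)
Definition sweep (S : pred bool) gs : prog mark :=
  While (fun r => r.1.2 != stop)
    (Seq (emits gs)
      (Act (fun r => ((r.1.1, if has_side S r.1.2 then Right else Stay),
                      (r.1.2, Right), (r.2, Stay))))).

(** Outside [S] the symbol [x] on the first tape is arbitrary, so the output must not depend on it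
    there. A round takes [size gs + 1] steps to write, one to move and one for the guard. *)
Lemma sweep_runs (T : Type) (S : pred bool) gs (c : T -> bool * bool) (e : T -> bool)
    (out : T -> seq bool) (vs : seq T) l0 r0 l1 r1 o :
  (forall v x, (S (c v).1 -> x = bit (e v)) -> [seq g x (cell (c v)) | g <- gs] = out v) ->
  let w := [seq bit (e v) | v <- vs & S (c v).1] in
  let cs := [seq cell (c v) | v <- vs] in
  runs (sweep S gs) ((size gs + 3) * size vs + 1)
    (tape_at l0 (w ++ r0), tape_at l1 (cs ++ stop :: r1), tape_at o [::])
    (tape_at (rev w ++ l0) r0, tape_at (rev cs ++ l1) (stop :: r1),
     tape_at (wrote (flatten (map out vs)) o) [::]).
Proof.
move=> Hout; elim: vs l0 l1 o => [|v vs IH] l0 l1 o /=.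
  by rewrite muln0; exact: runs_while_stop.
have -> : (size gs + 3) * (size vs).+1 + 1 =
    ((size gs).+1 + 1 + ((size gs + 3) * size vs + 1)).+1 by lia.
rewrite -wrote_cat [rev (cell _ :: _)]rev_cons cat_rcons.
case Sv: (S (c v).1) => /=.
  rewrite rev_cons cat_rcons.
  apply: (runs_while_next _ (runs_seq (emits_runs _ _ _ _ _ _) (runs_act _ _))) => //.
  rewrite (Hout v) //= /perform /= Sv.
  exact: IH.
apply: (runs_while_next _ (runs_seq (emits_runs _ _ _ _ _ _) (runs_act _ _))) => //.
rewrite (Hout v) ?Sv //= /perform /= Sv.
exact: IH.
Qed.

Lemma sweep_runs0 (T : Type) gs (c : T -> bool * bool) (out : T -> seq bool)
    (vs : seq T) l0 r0 l1 r1 o :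
  (forall v x, [seq g x (cell (c v)) | g <- gs] = out v) ->
  let cs := [seq cell (c v) | v <- vs] in
  runs (sweep pred0 gs) ((size gs + 3) * size vs + 1)
    (tape_at l0 r0, tape_at l1 (cs ++ stop :: r1), tape_at o [::])
    (tape_at l0 r0, tape_at (rev cs ++ l1) (stop :: r1),
     tape_at (wrote (flatten (map out vs)) o) [::]).
Proof.
move=> Hout cs; have := @sweep_runs T pred0 gs c xpred0 out vs l0 r0 l1 r1 o.
by rewrite filter_pred0; apply.
Qed.

(** The first move leaves the scanned cell, which may be the right end marker. With a side [S] the
    first head goes back over the row just read, ready for the next layer. *)
Definition rewind (S : pred bool) : prog mark :=
  Seq (Act (fun r => ((r.1.1, Stay), (r.1.2, Left), (r.2, Stay))))
    (Seq
      (While (fun r => r.1.2 != stop)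
        (Act (fun r => ((r.1.1, if has_side S r.1.2 then Left else Stay),
                        (r.1.2, Left), (r.2, Stay)))))
      (Act (fun r => ((r.1.1, Stay), (r.1.2, Right), (r.2, Stay))))).

Lemma rewind_runs (T : Type) (S : pred bool) (c : T -> bool * bool) (e : T -> bool)
    (vs : seq T) l0 y r0 x r1 o :
  let w := [seq bit (e v) | v <- vs & S (c v).1] in
  let cs := [seq cell (c v) | v <- vs] in
  runs (rewind S) (2 * size vs + 3)
    (tape_at (rev w ++ l0) (y :: r0), tape_at (rev cs ++ [:: stop]) (x :: r1), tape_at o [::])
    (tape_at l0 (w ++ y :: r0), tape_at [:: stop] (cs ++ x :: r1), tape_at o [::]).
Proof.
move=> w cs; have -> : 2 * size vs + 3 = 1 + ((2 * size vs + 1) + 1) by lia.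
apply: (runs_seq (runs_act _ _)).
apply: (@runs_seq _ _ _ _ _ _
  (tape_at l0 (w ++ y :: r0), tape_at [::] (stop :: cs ++ x :: r1), tape_at o [::]));
  last exact: runs_act.
rewrite /perform /= {}/w {}/cs.
elim/last_ind: vs y r0 x r1 => [|vs v IH] y r0 x r1.
  exact: runs_while_stop.
rewrite filter_rcons !map_rcons size_rcons [rev (rcons _ (cell _))]rev_rcons /=.
have -> : 2 * (size vs).+1 + 1 = (1 + (2 * size vs + 1)).+1 by lia.
rewrite cat_rcons; case Sv: (S (c v).1); rewrite ?map_rcons ?rev_rcons ?cat_rcons.
  apply: (runs_while_next _ (runs_act _ _)) => //.
  rewrite /perform /= Sv /=; exact: IH.
apply: (runs_while_next _ (runs_act _ _)) => //.
rewrite /perform /= Sv /=; exact: IH.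
Qed.

(* The scanned cell may lie beyond [r], in which case it becomes explicit once
   the head has moved away from it. *)
Definition explicit (r : seq sym) : seq sym := head blank r :: behead r.

Lemma rewind_runs0 (T : Type) (c : T -> bool * bool) (vs : seq T) l0 r0 x r1 o :
  let cs := [seq cell (c v) | v <- vs] in
  runs (rewind pred0) (2 * size vs + 3)
    (tape_at l0 r0, tape_at (rev cs ++ [:: stop]) (x :: r1), tape_at o [::])
    (tape_at l0 r0, tape_at [:: stop] (cs ++ x :: r1), tape_at o [::]).
Proof.
move=> cs; have := @rewind_runs T pred0 c xpred0 vs l0 (head blank r0) (behead r0) x r1 o.
by rewrite filter_pred0; apply.
Qed.

(** * Programs for the rows and for the reduction *)

Definition row_base (x : base) : prog mark :=
  Seq (emits [seq (fun _ _ => base_arc x y) | y <- bases])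
    (Seq (sweep pred0 [seq (fun _ c => base_layer_arc x l (side_of c)) | l <- layers])
      (rewind pred0)).

(** The mark decides equality with the current vertex and the input bit decides adjacency, which is
    false across sides whatever is scanned. *)
Definition row_layer (s : bool) (l : layer) : prog mark :=
  Seq (emits [seq (fun _ _ => layer_base_arc l s y) | y <- bases])
    (Seq (sweep (pred1 s)
           [seq (fun b c => layer_arc l l' (mark_of c) ((side_of c == s) && (b == bit true)))
              | l' <- layers])
      (rewind (pred1 s))).

Definition advance (s : bool) : prog mark :=
  Seq (sweep (pred1 s) [::]) (rewind pred0).

Definition row_group (s : bool) : prog mark :=
  Seq (row_layer s L0) (Seq (row_layer s L1) (Seq (row_layer s L2) (advance s))).

(* The mark of the current vertex lets [p] recognise the diagonal entries. *)
Definition for_each (s : bool) (p : prog mark) : prog mark :=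
  While (fun r => has_side (pred1 s) r.1.2)
    (Seq (Act (fun r => ((r.1.1, Stay), (cell (s, true), Stay), (r.2, Stay))))
      (Seq (rewind pred0)
        (Seq p
          (Seq
            (While (fun r => ~~ mark_of r.1.2)
              (Act (fun r => ((r.1.1, Stay), (r.1.2, Right), (r.2, Stay)))))
            (Act (fun r => ((r.1.1, Stay), (cell (s, false), Right), (r.2, Stay)))))))).

Definition skip_order : prog mark :=
  Seq
    (While (fun r => r.1.1 == bit true)
      (Act (fun r => ((r.1.1, Right), (r.1.2, Stay), (r.2, Stay)))))
    (Act (fun r => ((r.1.1, Right), (r.1.2, Stay), (r.2, Stay)))).

(** For the second graph the new cells overwrite the end marker of the first list. *)
Definition read_order (s : bool) : prog mark :=
  Seq
    (While (fun r => r.1.1 == bit true)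
      (Act (fun r => ((r.1.1, Right), (cell (s, false), Right), (r.2, Stay)))))
    (Seq (Act (fun r => ((r.1.1, Right), (stop, Stay), (r.2, Stay)))) (rewind pred0)).

Definition restart : prog mark :=
  Seq (Act (fun r => ((r.1.1, Left), (r.1.2, Stay), (r.2, Stay))))
    (Seq
      (While (fun r => r.1.1 != blank)
        (Act (fun r => ((r.1.1, Left), (r.1.2, Stay), (r.2, Stay)))))
      (Act (fun r => ((r.1.1, Right), (r.1.2, Stay), (r.2, Stay))))).

Definition write_order : prog mark :=
  Seq (emits (nseq 8 (fun _ _ => true)))
    (Seq (sweep pred0 (nseq 3 (fun _ _ => true)))
      (Seq (emits [:: fun _ _ => false]) (rewind pred0))).

Definition base_rows : prog mark :=
  foldr (fun x p => Seq (row_base x) p) (Act (@idle mark)) bases.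

(** The output is copied from its last bit backwards, starting at the blank after the input, so that
    only blanks follow it. What remains to its left is not seen by [holds_word]. *)
Definition deliver : prog mark :=
  Seq (Act (fun r => ((r.1.1, Stay), (r.1.2, Stay), (r.2, Left))))
    (Seq
      (While (fun r => r.2 != blank)
        (Act (fun r => ((r.2, Left), (r.1.2, Stay), (r.2, Left)))))
      (Act (fun r => ((r.1.1, Right), (r.1.2, Stay), (r.2, Stay))))).

(** Every output row involves both graphs, so a first pass lists all vertices on the second tape,
    crossing the matrix of A by [advance]; the rows are written in a second pass. *)
Definition main_prog : prog mark :=
  Seq (Act (fun r => ((r.1.1, Stay), (stop, Right), (r.2, Stay))))
    (Seq (read_order false)
    (Seq (for_each false (advance false))
    (Seq (read_order true)
    (Seq restart
    (Seq skip_order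
    (Seq write_order
    (Seq base_rows
    (Seq (for_each false (row_group false))
    (Seq skip_order
    (Seq (for_each true (row_group true))
      deliver)))))))))).

(** * Effects and running times of the programs *)

Lemma skip_order_runs n l0 r0 l1 r1 o :
  runs skip_order (2 * n + 2)
    (tape_at l0 (map bit (nseq n true) ++ bit false :: r0), tape_at l1 r1, tape_at o [::])
    (tape_at (wrote (rcons (nseq n true) false) l0) r0, tape_at l1 r1, tape_at o [::]).
Proof.
have -> : 2 * n + 2 = (2 * n + 1) + 1 by lia.
apply: (@runs_seq _ _ _ _ _ _ (tape_at (wrote (nseq n true) l0) (bit false :: r0),
  tape_at l1 r1, tape_at o [::])).
  elim: n l0 => [|n IH] l0; first exact: runs_while_stop.
  have -> : 2 * n.+1 + 1 = (1 + (2 * n + 1)).+1 by lia.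
  apply: (runs_while_next _ (runs_act _ _)) => //.
  by rewrite /wrote /= rev_cons cat_rcons; exact: IH.
by rewrite /wrote map_rcons rev_rcons; exact: runs_act.
Qed.

Lemma restart_runs w y r0 l1 r1 o :
  runs restart (2 * size w + 3)
    (tape_at (wrote w [::]) (y :: r0), tape_at l1 r1, tape_at o [::])
    (tape_at [:: blank] (map bit w ++ y :: r0), tape_at l1 r1, tape_at o [::]).
Proof.
rewrite /wrote cats0; have -> : 2 * size w + 3 = 1 + ((2 * size w + 1) + 1) by lia.
apply: (runs_seq (runs_act _ _)).
apply: (@runs_seq _ _ _ _ _ _ (tape_at [::] (blank :: map bit w ++ y :: r0),
  tape_at l1 r1, tape_at o [::])); last exact: runs_act.
elim/last_ind: w y r0 => [|w b IH] y r0; first exact: runs_while_stop.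
rewrite size_rcons map_rcons rev_rcons cat_rcons.
have -> : 2 * (size w).+1 + 1 = (1 + (2 * size w + 1)).+1 by lia.
apply: (runs_while_next _ (runs_act _ _)) => //.
exact: IH.
Qed.

Lemma deliver_runs w l0 l1 r1 : w != [::] ->
  exists2 T, runs deliver (2 * size w + 3)
    (tape_at l0 [::], tape_at l1 r1, tape_at (wrote w [::]) [::]) T
    & holds_word T.1.1 w.
Proof.
rewrite /wrote cats0 => nw.
pose loop := While (fun r : reads mark => r.2 != blank)
  (Act (fun r => ((r.2, Left), (r.1.2, Stay), (r.2, Left)))).
(* Only the part of the first tape to the right of the head is tracked, as [holds_word] will need no
   more. *)
have H t0 r2 : exists t0' t2,
    runs loop (2 * size w + 1)
      (t0, tape_at l1 r1, tape_at (behead (rev (map bit w))) (head blank (rev (map bit w)) :: r2))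
      (t0', tape_at l1 r1, t2) /\ after t0' = map bit w ++ after t0.
  elim/last_ind: {nw} w t0 r2 => [|w b IH] t0 r2.
    by exists t0, (tape_at [::] (blank :: r2)); split=> //; exact: runs_while_stop.
  rewrite size_rcons map_rcons rev_rcons /=.
  have -> : 2 * (size w).+1 + 1 = (1 + (2 * size w + 1)).+1 by lia.
  have [t0' [t2 [H E]]] := IH (write_move t0 (bit b, Left)) (bit b :: r2).
  exists t0', t2; split; last by rewrite E cat_rcons.
  by apply: (runs_while_next _ (runs_act _ _)).
have [t0 [t2 [{}H E]]] := H (tape_at l0 [::]) [:: blank].
exists (write_move t0 (scanned t0, Right), tape_at l1 r1, t2).
  have -> : 2 * size w + 3 = 1 + ((2 * size w + 1) + 1) by lia.
  apply: (runs_seq (runs_act _ _)); apply: (runs_seq H).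
  by case: t2 {H} => [? ? ?]; exact: runs_act.
exists 0; rewrite /= E /= !cats0; by case: w nw {H E}.
Qed.

Section Rows.

Variables (I : eqType) (side : I -> bool) (adj : rel I) (vs : seq I).
Hypothesis adj_side : forall u v, adj u v -> side v = side u.

Definition cells (m : I -> bool) (us : seq I) : seq sym :=
  [seq cell (side v, m v) | v <- us].

(** The row of [u] in the input matrix of its own graph. *)
Definition row_bits (u : I) : seq bool := [seq adj u v | v <- vs & side v == side u].

Definition base_row (x : base) : seq bool :=
  [seq base_arc x y | y <- bases] ++
  flatten [seq [seq base_layer_arc x l (side v) | l <- layers] | v <- vs].

Definition layer_row (u : I) (l : layer) : seq bool :=
  [seq layer_base_arc l (side u) y | y <- bases] ++
  flatten [seq [seq layer_arc l l' (u == v) (adj u v) | l' <- layers] | v <- vs].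

Notation output o := (tape_at o [::]).
Notation ready m := (tape_at [:: stop] (cells m vs ++ [:: stop])).

Lemma row_base_runs x m l0 r0 o :
  runs (row_base x) (8 * size vs + 13)
    (tape_at l0 r0, ready m, output o)
    (tape_at l0 r0, ready m, output (wrote (base_row x) o)).
Proof.
have -> : 8 * size vs + 13 = 9 + ((6 * size vs + 1) + (2 * size vs + 3)) by lia.
rewrite /base_row -wrote_cat; pose c v := (side v, m v).
apply: (runs_seq (emits_runs _ _ _ _ _ _)) => /=.
apply: runs_seq; last exact: (rewind_runs0 c).
by apply: (sweep_runs0 (c := c)) => v y.
Qed.

Lemma row_layer_runs s u l l0 r0 o : side u = s ->
  runs (row_layer s l) (8 * size vs + 13)
    (tape_at l0 (map bit (row_bits u) ++ r0), ready (eq_op u), output o)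
    (tape_at l0 (map bit (row_bits u) ++ explicit r0), ready (eq_op u),
     output (wrote (layer_row u l) o)).
Proof.
move=> Su; have -> : 8 * size vs + 13 = 9 + ((6 * size vs + 1) + (2 * size vs + 3)) by lia.
rewrite /layer_row -wrote_cat; pose c v := (side v, u == v).
have -> : map bit (row_bits u) = [seq bit (adj u v) | v <- vs & pred1 s (c v).1] :> seq sym.
  by rewrite /row_bits Su -map_comp.
apply: (runs_seq (emits_runs _ _ _ _ _ _)) => /=; rewrite Su.
apply: runs_seq; last exact: (rewind_runs (pred1 s) c).
apply: (sweep_runs (c := c)) => v x /= Ex.
(* On the other side [x] is arbitrary, but there [adj_side] makes [adj u v] false. *)
have -> // : (side v == s) && (x == bit true) = adj u v.
case: eqP Ex => [_ -> //|nS _]; first by case: (adj u v).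
by apply/esym/negP => /adj_side; rewrite Su.
Qed.

Lemma advance_runs s u l0 r0 o : side u = s ->
  runs (advance s) (5 * size vs + 4)
    (tape_at l0 (map bit (row_bits u) ++ r0), ready (eq_op u), output o)
    (tape_at (wrote (row_bits u) l0) r0, ready (eq_op u), output o).
Proof.
move=> Su; have -> : 5 * size vs + 4 = (3 * size vs + 1) + (2 * size vs + 3) by lia.
pose c v := (side v, u == v); rewrite /wrote.
have -> : map bit (row_bits u) = [seq bit (adj u v) | v <- vs & pred1 s (c v).1] :> seq sym.
  by rewrite /row_bits Su -map_comp.
apply: runs_seq; last exact: (rewind_runs0 c).
have H := @sweep_runs I (pred1 s) [::] c (adj u) (fun=> [::]) vs l0 r0 [:: stop] [::] o
  (fun _ _ _ => erefl).
have E : flatten [seq [::] | _ <- vs] = [::] :> seq bool by elim: (vs).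
by rewrite /= E in H.
Qed.

Definition group_rows (u : I) : seq bool := flatten [seq layer_row u l | l <- layers].

Lemma group_rowsE u : group_rows u = layer_row u L0 ++ layer_row u L1 ++ layer_row u L2.
Proof. by rewrite -[layer_row u L2]cats0. Qed.

Lemma row_group_runs s u l0 r0 o : side u = s ->
  runs (row_group s) (29 * size vs + 43)
    (tape_at l0 (map bit (row_bits u) ++ r0), ready (eq_op u), output o)
    (tape_at (wrote (row_bits u) l0) r0, ready (eq_op u),
     output (wrote (group_rows u) o)).
Proof.
move=> Su; rewrite group_rowsE -[wrote (layer_row u L0 ++ _) o]wrote_cat -[wrote (layer_row u L1 ++ _) _]wrote_cat.
have -> : 29 * size vs + 43 = (8 * size vs + 13) + ((8 * size vs + 13)
  + ((8 * size vs + 13) + (5 * size vs + 4))) by lia.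
apply: (runs_seq (row_layer_runs _ _ _ _ Su)).
apply: (runs_seq (row_layer_runs _ _ _ _ Su)).
apply: (runs_seq (row_layer_runs _ _ _ _ Su)).
(* Up to conversion [explicit] is idempotent and does not change [tape_at]. *)
exact: (@advance_runs _ _ _ (explicit r0) _ Su).
Qed.

Lemma seek_runs us t0 l1 r1 t2 x : mark_of x ->
  runs (While (fun r => ~~ mark_of r.1.2)
          (Act (fun r => ((r.1.1, Stay), (r.1.2, Right), (r.2, Stay)))))
    (2 * size us + 1)
    (t0, tape_at l1 (cells xpred0 us ++ x :: r1), t2)
    (t0, tape_at (rev (cells xpred0 us) ++ l1) (x :: r1), t2).
Proof.
move=> mx; elim: us l1 => [|u us IH] l1; first by apply: runs_while_stop; rewrite negbK.
have -> : 2 * size (u :: us) + 1 = (1 + (2 * size us + 1)).+1 by rewrite /=; lia.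
apply: (runs_while_next _ (runs_act _ _)) => //.
rewrite /= rev_cons cat_rcons.
by case: t0 t2 IH => [? ? ?] [? ? ?] IH; exact: IH.
Qed.

(** The loop has passed [pre] and still has to treat [us]; it stops at the first vertex of [post],
    or at the end marker. *)
Lemma for_each_runs s p tp (w out : I -> seq bool) pre us post l0 r0 o :
  uniq vs -> pre ++ us ++ post = vs ->
  (forall u, u \in us -> side u = s) ->
  (forall u, u \in post -> side u != s) ->
  (forall u l0 r0 o, side u = s ->
     runs p tp (tape_at l0 (map bit (w u) ++ r0), ready (eq_op u), output o)
       (tape_at (wrote (w u) l0) r0, ready (eq_op u), output (wrote (out u) o))) ->
  runs (for_each s p) ((tp + 4 * size vs + 8) * size us + 1)
    (tape_at l0 (map bit (flatten (map w us)) ++ r0),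
     tape_at (rev (cells xpred0 pre) ++ [:: stop]) (cells xpred0 (us ++ post) ++ [:: stop]),
     output o)
    (tape_at (wrote (flatten (map w us)) l0) r0,
     tape_at (rev (cells xpred0 (pre ++ us)) ++ [:: stop]) (cells xpred0 post ++ [:: stop]),
     output (wrote (flatten (map out us)) o)).
Proof.
move=> uniq_vs Evs Sus Spost Hp; elim: us pre l0 o Evs Sus => [|u us IH] pre l0 o Evs Sus.
  rewrite cats0 muln0; apply: runs_while_stop; case: post Spost {Evs} => //= v post Spost.
  by apply: Spost; rewrite mem_head.
have Su : side u = s by apply: Sus; rewrite mem_head.
have Nu : u \notin pre ++ us ++ post.
  by move: uniq_vs; rewrite -Evs uniq_catCA /= !mem_cat orbCA => /andP[].
have neq_u v : v \in pre ++ us ++ post -> (u == v) = false.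
  by move=> vin; apply/eqP => Euv; rewrite Euv vin in Nu.
(* Since [vs] has no duplicates, marking one cell produces the marks [eq_op u]. *)
have marked : cells (eq_op u) vs = cells xpred0 pre ++ cell (s, true) :: cells xpred0 (us ++ post).
  rewrite -Evs /cells map_cat /= eqxx Su; congr (_ ++ _ :: _); apply/eq_in_map => v vin;
  by rewrite neq_u // mem_cat vin ?orbT.
have {}IH := IH (rcons pre u).
rewrite [cells _ (rcons _ _)]map_rcons rev_rcons !cat_rcons /= Su in IH.
(* The summand [4 * (size vs - size pre) + 1] is slack, which makes the cost per vertex independent
   of [pre]; [runs_le] drops it. *)
have -> : (tp + 4 * size vs + 8) * size (u :: us) + 1 =
  (1 + ((2 * size pre + 3) + (tp + ((2 * size pre + 1) + 1)))
    + ((tp + 4 * size vs + 8) * size us + 1) + (4 * (size vs - size pre) + 1)).+1.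
  have : size pre <= size vs by rewrite -Evs size_cat leq_addr.
  by rewrite /=; nia.
have {}Sus v : v \in us -> side v = s by move=> vus; apply: Sus; rewrite inE vus orbT.
apply: (@runs_le _ _ ((1 + ((2 * size pre + 3) + (tp + ((2 * size pre + 1) + 1)))
    + ((tp + 4 * size vs + 8) * size us + 1)).+1)); first by rewrite ltnS leq_addr.
rewrite [flatten (map w _)]/= [flatten (map out _)]/= -[wrote (out u ++ _) o]wrote_cat -[wrote (w u ++ _) l0]wrote_cat.
have {}marked : cells (eq_op u) vs ++ [:: stop] =
    cells xpred0 pre ++ cell (s, true) :: (cells xpred0 (us ++ post) ++ [:: stop]).
  by rewrite marked -catA.
have := Hp u l0 (map bit (flatten (map w us)) ++ r0) o Su; rewrite marked => Hu.
rewrite map_cat -catA.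
apply: (runs_while_next _ _ (IH _ _ Evs Sus)); first by rewrite /= Su eqxx.
apply: (runs_seq (runs_act _ _)).
apply: (runs_seq (rewind_runs0 (fun v => (side v, false)) _ _ _ _ _ _)).
apply: (runs_seq Hu).
by apply: (runs_seq (seek_runs _ _ _ _ _ _)).
Qed.

(** [r1] is empty for the first graph and the old end marker for the second; having at most one
    cell, it is overwritten completely. *)
Lemma read_order_runs s pre us l0 r0 r1 o :
  (forall u, u \in us -> side u = s) -> size r1 <= 1 ->
  runs (read_order s) (2 * size pre + 4 * size us + 5)
    (tape_at l0 (map bit (nseq (size us) true) ++ bit false :: r0),
     tape_at (rev (cells xpred0 pre) ++ [:: stop]) r1, output o)
    (tape_at (wrote (rcons (nseq (size us) true) false) l0) r0,
     tape_at [:: stop] (cells xpred0 (pre ++ us) ++ [:: stop]), output o).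
Proof.
move=> Sus sz1.
have -> : 2 * size pre + 4 * size us + 5 =
  (2 * size us + 1) + (1 + (2 * size (pre ++ us) + 3)) by rewrite size_cat; lia.
have [r1' sz1' H] : exists2 r1', size r1' <= 1 &
    runs (While (fun r => r.1.1 == bit true)
      (Act (fun r => ((r.1.1, Right), (cell (s, false), Right), (r.2, Stay)))))
    (2 * size us + 1)
    (tape_at l0 (map bit (nseq (size us) true) ++ bit false :: r0),
     tape_at (rev (cells xpred0 pre) ++ [:: stop]) r1, output o)
    (tape_at (wrote (nseq (size us) true) l0) (bit false :: r0),
     tape_at (rev (cells xpred0 (pre ++ us)) ++ [:: stop]) r1', output o).
  elim: us pre l0 r1 Sus sz1 => [|u us IH] pre l0 r1 Sus sz1.
    by exists r1 => //; rewrite cats0; exact: runs_while_stop.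
  have [||r1' sz1' H] := IH (rcons pre u) (bit true :: l0) (behead r1).
  - by move=> v vus; apply: Sus; rewrite inE vus orbT.
  - by rewrite size_behead; lia.
  exists r1' => //.
  have -> : 2 * size (u :: us) + 1 = (1 + (2 * size us + 1)).+1 by rewrite /=; lia.
  apply: (runs_while_next _ (runs_act _ _)) => //.
  move: H; rewrite [cells _ (rcons pre u)]map_rcons rev_rcons Sus ?mem_head //.
  by rewrite /wrote /= rev_cons !cat_rcons; exact.
apply: (runs_seq H); apply: (runs_seq (runs_act _ _)).
rewrite /wrote map_rcons rev_rcons.
have := @rewind_runs0 I (fun v => (side v, false)) (pre ++ us).
case: r1' sz1' {H} => [|x [|]] // _; exact.
Qed.

Lemma write_order_runs l0 r0 :
  runs write_order (8 * size vs + 15)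
    (tape_at l0 r0, ready xpred0, output [::])
    (tape_at l0 r0, ready xpred0,
     output (wrote (rcons (nseq (8 + 3 * size vs) true) false) [::])).
Proof.
have -> : 8 * size vs + 15 = 9 + ((6 * size vs + 1) + (2 + (2 * size vs + 3))) by lia.
pose c v := (side v, false).
have E : flatten [seq nseq 3 true | _ <- vs] = nseq (3 * size vs) true.
  by elim: (vs) => [|v us IH] //; rewrite mulnS nseqD -IH.
rewrite -cats1 -wrote_cat nseqD -wrote_cat -E.
apply: (runs_seq (emits_runs _ _ _ _ _ _)).
apply: (runs_seq (@sweep_runs0 I _ c (fun=> nseq 3 true) vs _ _ _ _ _ _)) => //.
apply: (runs_seq (emits_runs _ _ _ _ _ _)).
exact: (rewind_runs0 c).
Qed.

Lemma base_rows_runs l0 r0 o :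
  runs base_rows (64 * size vs + 105)
    (tape_at l0 r0, ready xpred0, output o)
    (tape_at l0 r0, ready xpred0, output (wrote (flatten (map base_row bases)) o)).
Proof.
have -> : 64 * size vs + 105 = (8 * size vs + 13) * size bases + 1 by rewrite /=; lia.
rewrite /base_rows; elim: bases o => [|x xs IH] o.
  by rewrite muln0; exact: runs_act.
rewrite mulnS -addnA -[flatten (map _ (x :: xs))]/(base_row x ++ flatten (map base_row xs)).
rewrite -[wrote (base_row x ++ _) o]wrote_cat.
by apply: (runs_seq (row_base_runs _ _ _ _ _)).
Qed.

End Rows.

(** * The run of the whole program *)

Section Main.

Variables (I : eqType) (side : I -> bool) (adj : rel I) (us0 us1 : seq I).
Hypothesis adj_side : forall u v, adj u v -> side v = side u.
Hypothesis side0 : forall u, u \in us0 -> side u = false.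
Hypothesis side1 : forall u, u \in us1 -> side u = true.

Let vs := us0 ++ us1.
Hypothesis uniq_vs : uniq vs.

Let bits0 := flatten (map (row_bits side adj vs) us0).
Let bits1 := flatten (map (row_bits side adj vs) us1).

Definition input_word : seq bool :=
  nseq (size us0) true ++ false :: bits0 ++ nseq (size us1) true ++ false :: bits1.

Definition output_word : seq bool :=
  nseq (8 + 3 * size vs) true ++ false :: flatten (map (base_row side vs) bases) ++
  flatten (map (group_rows side adj vs) us0) ++ flatten (map (group_rows side adj vs) us1).

Definition main_time : nat :=
  let N := size vs in let S := size input_word in
  100 * (N + 1) * (N + 1) + 100 * (N + 1) + 2 * S + 2 * size output_word + 100.

(** In the first pass only [us0] is listed; [row_bits] keeps only vertices on the side of [u], so
    adding [us1] changes nothing. *)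
Lemma first_side_bits : flatten (map (row_bits side adj us0) us0) = bits0.
Proof.
congr flatten; apply/eq_in_map => u /side0 Su.
rewrite /row_bits /vs filter_cat map_cat -[LHS]cats0; congr (_ ++ _).
rewrite (@eq_in_filter _ _ pred0) ?filter_pred0 // => v /side1.
by rewrite Su => ->.
Qed.

Lemma main_runs : exists2 T,
  runs main_prog main_time
    (tape_at [::] (map bit input_word), tape_at [::] [::], tape_at [::] [::]) T
  & holds_word T.1.1 output_word.
Proof.
have uniq0 : uniq us0 by move: uniq_vs; rewrite cat_uniq => /and3P[].
(* The part of the input read before [restart]. *)
pose W := rcons (nseq (size us0) true) false ++ bits0 ++ rcons (nseq (size us1) true) false.
pose N := size vs.
have Evs : size us0 + size us1 = N by rewrite -size_cat.
have [T HT Hw] := @deliver_runs output_word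
  (wrote bits1 (wrote (rcons (nseq (size us1) true) false)
     (wrote bits0 (wrote (rcons (nseq (size us0) true) false) [:: blank]))))
  (rev (cells side xpred0 vs) ++ [:: stop]) [:: stop] isT.
exists T => //.
(* One summand for each component of [main_prog], in order. *)
apply: (@runs_le _ _ (1 + ((2 * 0 + 4 * size us0 + 5)
  + ((5 * size us0 + 4 + 4 * size us0 + 8) * size us0 + 1
  + ((2 * size us0 + 4 * size us1 + 5)
  + ((2 * size W + 3)
  + ((2 * size us0 + 2)
  + ((8 * N + 15)
  + ((64 * N + 105)
  + (((29 * N + 43) + 4 * N + 8) * size us0 + 1
  + ((2 * size us1 + 2)
  + (((29 * N + 43) + 4 * N + 8) * size us1 + 1
  + (2 * size output_word + 3))))))))))))).
  rewrite /main_time -/vs -/N /input_word !size_cat /= !size_cat /= !size_nseq.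
  rewrite !size_rcons !size_nseq; nia.
have E : map bit input_word = map bit (nseq (size us0) true) ++ bit false ::
    (map bit bits0 ++ (map bit (nseq (size us1) true) ++ bit false :: map bit bits1)) :> seq sym.
  by rewrite /input_word !(map_cat, map_cons).
rewrite {}E.
apply: (runs_seq (runs_act _ _)).
apply: (runs_seq (@read_order_runs I side false [::] us0 [::] _ [::] [::] side0 isT)).
have skip_group u l0 r0 o : side u = false ->
    runs (advance false) (5 * size us0 + 4)
      (tape_at l0 (map bit (row_bits side adj us0 u) ++ r0),
       tape_at [:: stop] (cells side (eq_op u) us0 ++ [:: stop]), tape_at o [::])
      (tape_at (wrote (row_bits side adj us0 u) l0) r0,
       tape_at [:: stop] (cells side (eq_op u) us0 ++ [:: stop]), tape_at (wrote [::] o) [::]).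
  exact: advance_runs.
have E0 : [::] ++ us0 ++ [::] = us0 by rewrite cats0.
have := for_each_runs (wrote (rcons (nseq (size us0) true) false) [::])
  (map bit (nseq (size us1) true) ++ bit false :: map bit bits1) [::] uniq0 E0 side0
  (fun=> ltac:(done)) skip_group.
have -> : flatten [seq [::] | _ <- us0] = [::] :> seq bool by elim: (us0).
rewrite first_side_bits cats0 => H; apply: (runs_seq H) => {H}.
apply: (runs_seq (@read_order_runs I side true us0 us1 _ _ [:: stop] [::] side1 isT)).
have -> : wrote (rcons (nseq (size us1) true) false)
    (wrote bits0 (wrote (rcons (nseq (size us0) true) false) [::])) = wrote W [::].
  by rewrite !wrote_cat /W catA.
(* If B has no vertices, the head stands on the blank beyond the input, which becomes explicit
   here. *)
apply: (runs_seq (restart_runs W (head blank (map bit bits1)) (behead (map bit bits1)) _ _ _)).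
have -> : map bit W ++ explicit (map bit bits1) = map bit (nseq (size us0) true) ++ bit false ::
    (map bit bits0 ++ (map bit (nseq (size us1) true) ++ bit false :: explicit (map bit bits1))).
  by rewrite /W !(map_cat, map_rcons, cat_rcons, =^~ catA).
apply: (runs_seq (skip_order_runs _ _ _ _ _ _)).
apply: (runs_seq (write_order_runs side vs _ _)).
apply: (runs_seq (base_rows_runs side vs _ _ _)).
have group s u l0 r0 o : side u = s -> _ := fun H => @row_group_runs I side adj vs adj_side s u l0 r0 o H.
have E1 : [::] ++ us0 ++ us1 = vs by [].
have nside1 u : u \in us1 -> side u != false by move/side1->.
apply: (runs_seq (for_each_runs _ _ _ uniq_vs E1 side0 nside1 (group false))).
apply: (runs_seq (skip_order_runs _ _ _ _ _ _)).
have E2 : us0 ++ us1 ++ [::] = vs by rewrite cats0.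
have := for_each_runs (wrote (rcons (nseq (size us1) true) false)
     (wrote bits0 (wrote (rcons (nseq (size us0) true) false) [:: blank]))) [::] _ uniq_vs E2 side1 (fun=> ltac:(done)) (group true).
rewrite !cats0 => H; apply: (runs_seq (H _)) => {H}.
have -> : wrote (flatten (map (group_rows side adj vs) us1))
    (wrote (flatten (map (group_rows side adj vs) us0))
       (wrote (flatten (map (base_row side vs) bases))
          (wrote (rcons (nseq (8 + 3 * size vs) true) false) [::]))) = wrote output_word [::].
  by rewrite !wrote_cat /output_word -cat_rcons !catA.
exact: HT.
Qed.

End Main.

(** * Tape words as codes of instances *)

Lemma enum_pair_rows A B (u : 'I_(order A) + 'I_(order B)) :
  row_bits (@pair_side A B) (@pair_adj A B) (pair_list A B) u =
  match u with
  | inl i => [seq entries A i j | j <- enum 'I_(order A)]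
  | inr i => [seq entries B i j | j <- enum 'I_(order B)]
  end.
Proof.
rewrite /row_bits /pair_list.
elim: (enum 'I_(order A)) => [|a s IH]; last by case: u IH => i /= ->.
by elim: (enum 'I_(order B)) => [|b s IH]; [case: u | case: u IH => i /= ->].
Qed.

Lemma input_word_code A B :
  input_word (@pair_side A B) (@pair_adj A B)
    (map inl (enum 'I_(order A))) (map inr (enum 'I_(order B))) = pair_code (A, B).
Proof.
have size_side (T : Type) n (f : 'I_n -> T) : size (map f (enum 'I_n)) = n.
  by rewrite size_map size_enum_ord.
have rows n (h : 'I_n -> 'I_(order A) + 'I_(order B)) (C : 'M[bool]_n) :
    (forall i, row_bits (@pair_side A B) (@pair_adj A B) (pair_list A B) (h i) =
       [seq C i j | j <- enum 'I_n]) ->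
    flatten (map (row_bits (@pair_side A B) (@pair_adj A B) (pair_list A B)) (map h (enum 'I_n))) =
    [seq C i j | i <- enum 'I_n, j <- enum 'I_n].
  by move=> hC; rewrite -map_comp; congr flatten; exact: eq_map.
rewrite /input_word !size_side (rows _ inl (entries A)) => [|i]; last exact: enum_pair_rows.
rewrite (rows _ inr (entries B)) => [|i]; last exact: enum_pair_rows.
by rewrite /pair_code /adjacency_code -catA.
Qed.

Lemma gadget_rows (I : finType) (side : I -> bool) (adj : rel I) (vs us : seq I) :
  [seq gadget_arc side adj x y | x <- gadget_list us, y <- gadget_list vs] =
  flatten (map (base_row side vs) bases) ++ flatten (map (group_rows side adj vs) us).
Proof.
pose row x := [seq gadget_arc side adj x y | y <- gadget_list vs].
have row_inl c : row (inl c) = base_row side vs c.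
  by rewrite /row /gadget_list map_cat map_flatten -!map_comp.
have row_inr u l : row (inr (u, l)) = layer_row side adj vs u l.
  by rewrite /row /gadget_list map_cat map_flatten -!map_comp.
rewrite -[LHS]/(flatten (map row (gadget_list us))) map_cat flatten_cat -map_comp.
congr (flatten _ ++ _); first exact: eq_map.
elim: us => [//|u us IH].
rewrite -[LHS]/(row (inr (u, L0)) ++ row (inr (u, L1)) ++ row (inr (u, L2)) ++
  flatten (map row [seq inr (v, l) | v <- us, l <- layers])).
rewrite -[RHS]/(group_rows side adj vs u ++ flatten (map (group_rows side adj vs) us)).
by rewrite group_rowsE IH !row_inr -!catA.
Qed.

Lemma output_word_code AB :
  output_word (@pair_side AB.1 AB.2) (@pair_adj AB.1 AB.2)
    (map inl (enum 'I_(order AB.1))) (map inr (enum 'I_(order AB.2))) =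
  adjacency_code (reduction AB).
Proof.
rewrite listed_code size_gadget_list /output_word -/(pair_list AB.1 AB.2).
congr (_ ++ _ :: _).
by rewrite gadget_rows /pair_list map_cat flatten_cat.
Qed.

Lemma size_adjacency_code A : size (adjacency_code A) = order A + (order A * order A).+1.
Proof. by rewrite size_cat size_nseq /= size_allpairs size_enum_ord. Qed.

Lemma reduction_poly_time : @poly_time GI HOMFULL reduction.
Proof.
exists (compile main_prog), 500, 2 => -[A B] _; rewrite /code /= -input_word_code.
have EO := output_word_code (A, B); have EI := input_word_code A B.
have [||||T HT Hw] := @main_runs _ (@pair_side A B) (@pair_adj A B)
  (map inl (enum 'I_(order A))) (map inr (enum 'I_(order B))).
- by move=> [i|i] [j|j].
- by move=> _ /mapP[i _ ->].
- by move=> _ /mapP[i _ ->].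
- exact: pair_list_uniq.
rewrite EO in Hw; apply: compile_computes Hw; apply: runs_le HT.
rewrite /main_time EO EI -/(pair_list A B) {EO EI}.
have -> : size (pair_code (A, B)) =
    order A + (order A * order A).+1 + (order B + (order B * order B).+1).
  by rewrite size_cat !size_adjacency_code.
rewrite size_adjacency_code.
rewrite -[order (reduction _)]/(size (gadget_list (pair_list A B))) size_gadget_list.
have -> : size (pair_list A B) = order A + order B.
  by rewrite size_cat [size (map inl _)]size_map [size (map inr _)]size_map !size_enum_ord.
move: (order A) (order B) => n m; rewrite -mulnn.
set S := (n + (n * n).+1 + (m + (m * m).+1)); set N := n + m.
have leS : N + 1 <= S by rewrite /N /S; nia.
have leSS : S <= S * S by rewrite /S; nia.
have : (N + 1) * (N + 1) <= S * S by exact: leq_mul.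
(* The output matrix has order [8 + 3 * N], at most [8 * (N + 1)] and hence at most [8 * S]. The
   constant [500] leaves room for all terms. *)
have : (8 + 3 * N) * (8 + 3 * N) <= 64 * (S * S) by nia.
lia.
Qed.

Theorem theorem15 : GI_hard HOMFULL.
Proof.
exists reduction; split; first exact: reduction_poly_time.
  exact: reduction_legal.
exact: reduction_correct.
Qed.
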